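(* Let $W=W(\Gamma,\mathbf m)$ be a graph product of primary cyclic groups. Then the following are equivalent: (1) $\operatorname{Out}^0W$ is an abelian group; (2) $\Gamma$ does not contain a SIL (separating intersection of links); (3) the outer automorphism group $\operatorname{Aut}W/\operatorname{Inn}W$ is finite.
   Context: $\Gamma$ is a finite simplicial graph with non-empty vertex set $V=\{v_1,\dots,v_N\}$, with the indexing fixed; $d$ is the path metric on $\Gamma$ (vertices in different components are at distance $\infty$). Each index $i$ is given a label $\mathbf m(i)$ which is a prime power $p^\alpha$, $\alpha\ge1$. The graph product of primary cyclic groups $W=W(\Gamma,\mathbf m)$ is the group with generators $V$ and relations $v_i^{\mathbf m(i)}=1$ and $v_jv_k=v_kv_j$ whenever $v_j,v_k$ are adjacent in $\Gamma$. $L_i$ (resp. $S_i$) is the link (resp. star) of $v_i$: the full subgraph on the vertices at distance exactly $1$ (resp. at most $1$) from $v_i$. For $1\le i\le N$ and $K$ a connected component of $\Gamma\setminus S_i$, the partial conjugation $\chi_{iK}$ is the automorphism of $W$ with $\chi_{iK}(v_j)=v_iv_jv_i^{-1}$ if $v_j\in K$ and $\chi_{iK}(v_j)=v_j$ if $v_j\notin K$. $\mathcal P$ is the set of all partial conjugations. For each $i$ with $\Gamma\setminus S_i\ne\emptyset$ let $j_i$ be minimal such that $v_{j_i}\in\Gamma\setminus S_i$, and let $\mathcal P^0=\{\chi_{iK}\in\mathcal P: v_{j_i}\notin K\}$. $\operatorname{Out}^0W$ is the subgroup of $\operatorname{Aut}W$ generated by $\mathcal P^0$. $\Gamma$ contains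 a SIL if there exist $1\le i<j\le N$ such that $d(v_i,v_j)\ge2$ and there is a connected component $R$ of $\Gamma\setminus(L_i\cap L_j)$ with $v_i,v_j\notin R$. *)

(* Defs.v *)
From HB Require Import structures.
From mathcomp Require Import all_boot.
From mathcomp Require Import boolp classical_sets cardinality.

Set Implicit Arguments.
Unset Strict Implicit.
Unset Printing Implicit Defensive.

Local Open Scope quotient_scope.
Local Open Scope group_scope.

(* Groups given by generators and relations. The letter (x, b) of a word      *)
(* stands for x if b = true and for the inverse of x if b = false; R l r is   *)
(* the defining relation l = r.                                               *)
Section Presentation.
Variable X : choiceType.

Definition word : Type := seq (X * bool).
HB.instance Definition _ := Choice.on word.

Definition inv_letter (a : X * bool) : X * bool := (a.1, ~~ a.2).
Definition inv_word (u : word) : word := rev (map inv_letter u).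

Variable R : word -> word -> Prop.

Inductive word_eq : word -> word -> Prop :=
| word_eq_refl u : word_eq u u
| word_eq_sym u v : word_eq u v -> word_eq v u
| word_eq_trans u v w : word_eq u v -> word_eq v w -> word_eq u w
| word_eq_cancel u a v : word_eq (u ++ [:: a; inv_letter a] ++ v) (u ++ v)
| word_eq_rel u l r v : R l r -> word_eq (u ++ l ++ v) (u ++ r ++ v).

Definition word_eqb (u v : word) : bool := `[< word_eq u v >].

Lemma word_eqb_refl : reflexive word_eqb.
Proof. by move=> u; apply/asboolP/word_eq_refl. Qed.

Lemma word_eqb_sym : symmetric word_eqb.
Proof.
by move=> u v; apply/asboolP/asboolP => ?; apply: word_eq_sym.
Qed.

Lemma word_eqb_trans : transitive word_eqb.
Proof.
move=> v u w /asboolP uv /asboolP vw; apply/asboolP.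
exact: word_eq_trans uv vw.
Qed.

Canonical word_equiv :=
  EquivRel word_eqb word_eqb_refl word_eqb_sym word_eqb_trans.

Definition presented : Type := {eq_quot word_equiv}.
HB.instance Definition _ := Choice.on presented.
HB.instance Definition _ := EqQuotient.on presented.

Definition presented_class (u : word) : presented := \pi_presented u.

Lemma presented_classP u v :
  presented_class u = presented_class v <-> word_eq u v.
Proof.
split=> [/eqP|uv]; first by rewrite /presented_class eqmodE => /asboolP.
by apply/eqP; rewrite /presented_class eqmodE; apply/asboolP.
Qed.

Lemma presented_reprK (x : presented) : presented_class (repr x) = x.
Proof. exact: reprK. Qed.

Lemma word_eq_ctx s t u v : word_eq u v -> word_eq (s ++ u ++ t) (s ++ v ++ t).
Proof.
elim=> {u v} [u|u v _ IH|u v w _ IH1 _ IH2|u a v|u l r v Rlr].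
- exact: word_eq_refl.
- exact: word_eq_sym.
- exact: word_eq_trans IH1 IH2.
- by have := word_eq_cancel (s ++ u) a (v ++ t); rewrite -!catA.
- by have := word_eq_rel (s ++ u) (v ++ t) Rlr; rewrite -!catA.
Qed.

Lemma word_eq_cat u u' v v' :
  word_eq u u' -> word_eq v v' -> word_eq (u ++ v) (u' ++ v').
Proof.
move=> uu' vv'; apply: (word_eq_trans (v := u' ++ v)).
  exact: (word_eq_ctx [::] v uu').
by have := word_eq_ctx u' [::] vv'; rewrite !cats0.
Qed.

Lemma inv_letterK : involutive inv_letter.
Proof. by case=> x b; rewrite /inv_letter /= negbK. Qed.

Lemma inv_wordK : involutive inv_word.
Proof.
move=> u; rewrite /inv_word map_rev revK -map_comp map_id_in // => a _ /=.
exact: inv_letterK.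
Qed.

Lemma word_eq_mulwV u : word_eq (u ++ inv_word u) [::].
Proof.
elim/last_ind: u => [|u a IH]; first exact: word_eq_refl.
rewrite /inv_word map_rcons rev_rcons cat_rcons.
exact: word_eq_trans (word_eq_cancel u a (inv_word u)) IH.
Qed.

Lemma word_eq_mulVw u : word_eq (inv_word u ++ u) [::].
Proof. by have := word_eq_mulwV (inv_word u); rewrite inv_wordK. Qed.

Lemma word_eq_inv u v : word_eq u v -> word_eq (inv_word u) (inv_word v).
Proof.
move=> uv; apply: (word_eq_trans (v := inv_word u ++ (v ++ inv_word v))).
  apply: word_eq_sym; rewrite -[X in word_eq _ X]cats0.
  exact: word_eq_cat (word_eq_refl _) (word_eq_mulwV v).
rewrite catA; apply: (word_eq_cat (u' := [::])) (word_eq_refl _).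
apply: (word_eq_trans (v := inv_word u ++ u)); last exact: word_eq_mulVw.
exact: word_eq_cat (word_eq_refl _) (word_eq_sym uv).
Qed.

Definition presented_one : presented := presented_class [::].
Definition presented_mul (x y : presented) : presented :=
  presented_class (repr x ++ repr y).
Definition presented_inv (x : presented) : presented :=
  presented_class (inv_word (repr x)).

Lemma repr_presented_class u : word_eq (repr (presented_class u)) u.
Proof. by apply/presented_classP; rewrite presented_reprK. Qed.

Lemma presented_mul_class u v :
  presented_mul (presented_class u) (presented_class v) =
  presented_class (u ++ v).
Proof. by apply/presented_classP/word_eq_cat; apply: repr_presented_class. Qed.

Lemma presented_inv_class u :
  presented_inv (presented_class u) = presented_class (inv_word u).
Proof. by apply/presented_classP/word_eq_inv/repr_presented_class. Qed.

Lemma presented_mulA : associative presented_mul.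
Proof.
move=> x y z.
rewrite -[x]presented_reprK -[y]presented_reprK -[z]presented_reprK.
by rewrite !presented_mul_class catA.
Qed.

Lemma presented_mul1 : left_id presented_one presented_mul.
Proof. by move=> x; rewrite -[x]presented_reprK presented_mul_class. Qed.

Lemma presented_mulx1 : right_id presented_one presented_mul.
Proof. by move=> x; rewrite -[x]presented_reprK presented_mul_class cats0. Qed.

Lemma presented_mulV : left_inverse presented_one presented_inv presented_mul.
Proof.
move=> x; rewrite -[x]presented_reprK presented_inv_class presented_mul_class.
exact/presented_classP/word_eq_mulVw.
Qed.

Lemma presented_mulxV : right_inverse presented_one presented_inv presented_mul.
Proof.
move=> x; rewrite -[x]presented_reprK presented_inv_class presented_mul_class.
exact/presented_classP/word_eq_mulwV.
Qed.

HB.instance Definition _ := isGroup.Build presented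
  presented_mulA presented_mul1 presented_mulx1 presented_mulV presented_mulxV.

Definition presented_gen (x : X) : presented := presented_class [:: (x, true)].

End Presentation.

(* The automorphism group of a group, with product (f * g)(x) = f (g x).      *)
Section Automorphisms.
Variable G : groupType.

Definition is_aut (f : G -> G) : bool :=
  `[< {morph f : x y / x * y} /\ bijective f >].

Record aut : Type := Aut { aut_fun :> G -> G; aut_funP : is_aut aut_fun }.
HB.instance Definition _ := [isSub for aut_fun].
HB.instance Definition _ := [Choice of aut by <:].

Lemma aut_eqP (f g : aut) : f =1 g -> f = g.
Proof. by move=> fg; apply/val_inj/funext. Qed.

Lemma autM (f : aut) : {morph f : x y / x * y}.
Proof. by case: f => f /= /asboolP[]. Qed.

Lemma aut_bij (f : aut) : bijective f.
Proof. by case: f => f /= /asboolP[]. Qed.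

Lemma aut_one_subproof : is_aut id.
Proof. by apply/asboolP; split=> //; exists id. Qed.
Definition aut_one : aut := Aut aut_one_subproof.

Lemma aut_mul_subproof (f g : aut) : is_aut (f \o g).
Proof.
apply/asboolP; split=> [x y /=|]; first by rewrite !autM.
by apply: bij_comp; apply: aut_bij.
Qed.
Definition aut_mul (f g : aut) : aut := Aut (aut_mul_subproof f g).

Lemma aut_inv_sig (f : aut) :
  {g : G -> G | [/\ is_aut g, cancel f g & cancel g f]}.
Proof.
apply: cid; case: (aut_bij f) => g fK gK; exists g; split=> //.
apply/asboolP; split; last by exists f.
by move=> x y; apply: (can_inj fK); rewrite autM !gK.
Qed.
Definition aut_inv (f : aut) : aut :=
  let: exist _ (And3 gP _ _) := aut_inv_sig f in Aut gP.

Lemma aut_mulA : associative aut_mul.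
Proof. by move=> f g h; apply: aut_eqP. Qed.
Lemma aut_mul1 : left_id aut_one aut_mul.
Proof. by move=> f; apply: aut_eqP. Qed.
Lemma aut_mulx1 : right_id aut_one aut_mul.
Proof. by move=> f; apply: aut_eqP. Qed.
Lemma aut_mulV : left_inverse aut_one aut_inv aut_mul.
Proof.
move=> f; apply: aut_eqP => x /=; rewrite /aut_inv.
by case: (aut_inv_sig f) => g [gP fK gK] /=.
Qed.
Lemma aut_mulxV : right_inverse aut_one aut_inv aut_mul.
Proof.
move=> f; apply: aut_eqP => x /=; rewrite /aut_inv.
by case: (aut_inv_sig f) => g [gP fK gK] /=.
Qed.

HB.instance Definition _ := isGroup.Build aut
  aut_mulA aut_mul1 aut_mulx1 aut_mulV aut_mulxV.

End Automorphisms.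

Local Open Scope classical_set_scope.

Definition is_subgroup (G : groupType) (H : set G) : Prop :=
  [/\ H 1, forall x y, H x -> H y -> H (x * y) & forall x, H x -> H x^-1].

Definition subgroup_gen (G : groupType) (A : set G) : set G :=
  smallest (@is_subgroup G) A.

Definition abelian_set (G : groupType) (H : set G) : Prop :=
  forall x y, H x -> H y -> commute x y.

Definition left_cosets (G : groupType) (H : set G) : set (set G) :=
  [set [set x * h | h in H] | x in [set: G]].

Definition Inn (G : groupType) : set (aut G) :=
  [set f | exists g, forall x, f x = g * x * g^-1].

(* The elements of the quotient Aut G / Inn G. *)
Definition Out (G : groupType) : set (set (aut G)) := left_cosets (@Inn G).

Local Close Scope classical_set_scope.

Section Graph.
Variables (T : finType) (e : rel T).

Definition walk (k : nat) (x y : T) : bool :=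
  [exists p : k.-tuple T, path e x p && (last x p == y)].

Lemma connect_walk x y : connect e x y -> exists k, walk k x y.
Proof.
case/connectP=> p ep ->; exists (size p); apply/existsP; exists (in_tuple p).
by rewrite ep eqxx.
Qed.

(* Path metric, with None for the distance infinity. *)
Definition gdist (x y : T) : option nat :=
  if @idP (connect e x y) is ReflectT xy then Some (ex_minn (connect_walk xy))
  else None.

Definition gdist_le (x y : T) (k : nat) : bool :=
  if gdist x y is Some d then (d <= k)%N else false.

Definition link (x : T) : {set T} := [set y | gdist x y == Some 1%N].
Definition star (x : T) : {set T} := [set y | gdist_le x y 1%N].

(* Vertex sets of the connected components of the full subgraph on A. *)
Definition components (A : {set T}) : {set {set T}} :=
  equivalence_partition
    (connect [rel x y | [&& x \in A, y \in A & e x y]]) A.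

End Graph.

Section GraphProduct.
Variables (N : nat) (e : rel 'I_N) (m : 'I_N -> nat).

Inductive graph_product_rel : word 'I_N -> word 'I_N -> Prop :=
| graph_product_torsion i : graph_product_rel (nseq (m i) (i, true)) [::]
| graph_product_comm j k : e j k ->
    graph_product_rel [:: (j, true); (k, true)] [:: (k, true); (j, true)].

Definition graph_product : groupType := presented graph_product_rel.

Definition vtx (i : 'I_N) : graph_product := presented_gen graph_product_rel i.

Definition is_partial_conj
    (i : 'I_N) (K : {set 'I_N}) (f : aut graph_product) : Prop :=
  K \in components e (~: star e i) /\
  forall j, f (vtx j) = if j \in K then vtx i * vtx j * (vtx i)^-1 else vtx j.

Definition min_outside_star (i j : 'I_N) : bool :=
  (j \notin star e i) && [forall k, (k \notin star e i) ==> (j <= k)%N].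

Definition partial_conj0 : set (aut graph_product) :=
  [set f | exists i j K,
    [/\ is_partial_conj i K f, min_outside_star i j & j \notin K]]%classic.

(* A subgroup of Aut W, despite the usual name Out^0 W. *)
Definition Out0 : set (aut graph_product) := subgroup_gen partial_conj0.

Definition contains_SIL : Prop :=
  exists i j : 'I_N, [/\ (i < j)%N, ~~ gdist_le e i j 1%N &
    exists R : {set 'I_N},
      [/\ R \in components e (~: (link e i :&: link e j)),
          i \notin R & j \notin R]].

End GraphProduct.

Definition prime_power (q : nat) : Prop :=
  exists p a, [/\ prime p, 0 < a & q = p ^ a]%N.

(* Main.v *)
(* For each [i] there is a map [proj i] from [W] to <v_i>, reading off the
   initial [v_i]-syllable; [x |-> proj i (g^-1 * x)] records on which side of
   the wall [g * <star i>] of the right-angled building of [W] the chamber [x]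
   lies. Walls of non-adjacent types do not cross, and this alone carries the
   whole argument.
   Without a SIL, the generators of [Out0] commute by inspection of supports.
   The automorphisms that map each [v_i] to a conjugate of itself are, by peak
   reduction, products of partial conjugations; they form a subgroup of finite
   index, since a torsion element is conjugate to one of length at most [N], so
   [W] has finitely many conjugacy classes of torsion elements. Hence Out is
   finite, commuting torsion elements generating a finite group.
   With a SIL, i.e. a component [R] common to the complements of the stars of
   [i] and [j], suitable partial conjugations by [v_i] and [v_j] in [Out0] do
   not commute, and no positive power of the product of the conjugations of [R] by [v_i]
   and [v_j] is inner. *)
Require Import Defs.
From mathcomp Require Import all_boot.
From mathcomp Require Import boolp classical_sets cardinality.

Set Implicit Arguments.
Unset Strict Implicit.
Unset Printing Implicit Defensive.

Local Open Scope group_scope.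

(** * Group presentations *)

Section Words.
Variables (X : choiceType) (R : word X -> word X -> Prop).

Lemma presented_class_cat (u v : word X) :
  presented_class R (u ++ v) =
  presented_class R u * presented_class R v :> presented R.
Proof. exact/esym/presented_mul_class. Qed.

Lemma presented_class_nil : presented_class R [::] = 1 :> presented R.
Proof. by []. Qed.

Definition letter_val (G : groupType) (phi : X -> G) (a : X * bool) : G :=
  if a.2 then phi a.1 else (phi a.1)^-1.

Lemma letter_val_inv (G : groupType) (phi : X -> G) a :
  letter_val phi (inv_letter a) = (letter_val phi a)^-1.
Proof. by case: a => x [] //=; rewrite /letter_val /= invgK. Qed.

Lemma presented_class_letter a :
  presented_class R [:: a] = letter_val (@presented_gen _ R) a.
Proof.
case: a => x [] //=; rewrite /letter_val /=.
exact/esym/(presented_inv_class R [:: (x, true)]).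
Qed.

Lemma presented_class_cons a u :
  presented_class R (a :: u) =
  letter_val (@presented_gen _ R) a * presented_class R u :> presented R.
Proof. by rewrite -cat1s presented_class_cat presented_class_letter. Qed.

Definition word_val (G : groupType) (phi : X -> G) (u : word X) : G :=
  \prod_(a <- u) letter_val phi a.

Lemma word_val_nseq (G : groupType) (phi : X -> G) n x :
  word_val phi (nseq n (x, true)) = phi x ^+ n.
Proof.
by elim: n => [|n IH]; rewrite /word_val ?big_nil //= big_cons expgS -IH.
Qed.

Lemma word_val_eq (G : groupType) (phi : X -> G) u v :
  (forall l r, R l r -> word_val phi l = word_val phi r) ->
  word_eq R u v -> word_val phi u = word_val phi v.
Proof.
move=> phiR; elim=> {u v} [//|u v _ -> //|u v w _ -> _ -> //|u a v|u l r v Rlr].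
  rewrite /word_val !big_cat /= big_cons big_seq1 letter_val_inv mulgV.
  by rewrite mul1g.
by rewrite /word_val !big_cat /= -!/(word_val _ _) (phiR _ _ Rlr).
Qed.

(** Von Dyck's theorem: [f] evaluates any representative word, and the relations make the value
    independent of it. *)
Lemma presented_lift (G : groupType) (phi : X -> G) :
  (forall l r, R l r -> word_val phi l = word_val phi r) ->
  exists f : presented R -> G,
    {morph f : x y / x * y} /\ forall x, f (presented_gen R x) = phi x.
Proof.
move=> phiR; pose f (x : presented R) := word_val phi (repr x).
have fE u : f (presented_class R u) = word_val phi u.
  exact/word_val_eq/repr_presented_class.
exists f; split=> [x y|x]; last by rewrite fE /word_val big_seq1.
rewrite -[x]presented_reprK -[y]presented_reprK -presented_class_cat !fE.
by rewrite /word_val big_cat.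
Qed.

End Words.

(** * Automorphism groups *)

Lemma aut_mulE (G : groupType) (f g : aut G) x : (f * g) x = f (g x).
Proof. by []. Qed.
Lemma aut_oneE (G : groupType) x : (1 : aut G) x = x.
Proof. by []. Qed.

Section AutGroup.
Variable G : groupType.

Lemma aut1 (f : aut G) : f 1 = 1.
Proof. by apply: (mulgI (f 1)); rewrite -autM !mulg1. Qed.

Lemma autV (f : aut G) : {morph f : x / x^-1}.
Proof. by move=> x; apply: (mulgI (f x)); rewrite -autM !mulgV aut1. Qed.

Lemma autX (f : aut G) n : {morph f : x / x ^+ n}.
Proof.
by move=> x; elim: n => [|n IH]; rewrite ?aut1 // !expgS autM IH.
Qed.

Lemma aut_KV (f : aut G) x : f (f^-1 x) = x.
Proof. by rewrite -aut_mulE mulgV. Qed.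

Lemma aut_VK (f : aut G) x : f^-1 (f x) = x.
Proof. by rewrite -aut_mulE mulVg. Qed.

Lemma inn_subproof (g : G) : is_aut (fun x => g * x * g^-1).
Proof.
apply/asboolP; split=> [x y|]; first by rewrite !mulgA mulgVK.
exists (fun x => g^-1 * x * g) => x.
  by rewrite !mulgA mulVg mul1g mulgVK.
by rewrite !mulgA mulgV mul1g mulgK.
Qed.
Definition inn (g : G) : aut G := Aut (inn_subproof g).

Lemma innE g x : inn g x = g * x * g^-1. Proof. by []. Qed.

Lemma InnP (f : aut G) : Inn f <-> exists g, f = inn g.
Proof.
split=> [[g fE]|[g ->]]; last by exists g.
by exists g; apply: aut_eqP.
Qed.

Lemma inn_autC (f : aut G) g : inn g * f = f * inn (f^-1 g).
Proof.
by apply: aut_eqP => x; rewrite !aut_mulE !innE !autM autV aut_KV.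
Qed.

Lemma innM g h : inn (g * h) = inn g * inn h.
Proof. by apply: aut_eqP => x; rewrite aut_mulE !innE invgM !mulgA. Qed.

Lemma inn1 : inn 1 = 1.
Proof. by apply: aut_eqP => x; rewrite innE mul1g invg1 mulg1. Qed.

End AutGroup.

(** * Sets of commuting elements *)

Lemma centralizer_subgroup (G : groupType) (A : set G) :
  is_subgroup [set x | forall y, A y -> commute x y]%classic.
Proof.
split=> [y _|x y xA yA z Az|x xA y Ay]; first exact/commute_sym/commute1.
  by apply/commute_sym/commuteM; apply/commute_sym; [apply: xA|apply: yA].
exact/commute_sym/commuteV/commute_sym/xA.
Qed.

Lemma abelian_subgroup_gen (G : groupType) (A : set G) :
  (forall x y, A x -> A y -> commute x y) -> abelian_set (subgroup_gen A).
Proof.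
move=> AC.
have genC : (subgroup_gen A `<=` [set x | forall y, A y -> commute x y])%classic.
  apply: smallest_sub; first exact: centralizer_subgroup.
  by move=> x Ax y; apply: AC.
suff genCC : (subgroup_gen A `<=`
    [set x | forall y, subgroup_gen A y -> commute x y])%classic.
  by move=> x y Ax Ay; apply: genCC.
apply: smallest_sub; first exact: centralizer_subgroup.
by move=> x Ax y /genC yC; apply/commute_sym/yC.
Qed.

(** Generators are adjoined one at a time: [F] grows to the products [y * g ^+ a] with [a] below an
    exponent of [g]. *)
Lemma commuting_torsion_finite (G : groupType) (s : seq G) :
  (forall x, x \in s -> exists2 n, (0 < n)%N & x ^+ n = 1) ->
  (forall x y, x \in s -> y \in s -> commute x y) ->
  exists F : set G, [/\ finite_set F, F 1 &
    forall x y, x \in s -> F y -> F (y * x)].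
Proof.
elim: s => [|g s IH] tors comm.
  by exists [set 1]%classic; split=> //; apply: finite_set1.
have [x xs|x y xs ys|F [Ffin F1 FM]] := IH.
- by apply: tors; rewrite inE xs orbT.
- by apply: comm; rewrite inE ?xs ?ys orbT.
have [|n n_gt0 gn] := tors g; first by rewrite inE eqxx.
exists [set z.1 * g ^+ z.2 | z in F `*` `I_n]%classic; split.
- by apply/finite_image/finite_setX => //; apply: finite_II.
- by exists (1, 0%N) => //=; rewrite mulg1.
move=> x _ /[!inE] /orP[/eqP->|xs] [[y a] /= [Fy an] <-].
  exists (y, a.+1 %% n)%N; first by split=> //=; rewrite /= ltn_mod.
  by rewrite /= -mulgA -expgSr {2}(divn_eq a.+1 n) expgnDr mulnC expgnA gn
    expg1n mul1g.
exists (y * x, a); first by split=> //; apply: FM.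
have C : commute x g by apply: comm; rewrite inE ?xs ?orbT ?eqxx.
by rewrite /= -!mulgA (commuteX a C).
Qed.

(** * Distances and components in a graph *)

Section GraphTheory.
Variables (T : finType) (e : rel T).

Lemma walk0 x y : walk e 0 x y = (x == y).
Proof.
apply/existsP/eqP => [[p]|->]; first by rewrite tuple0 /= => /eqP.
by exists [tuple]; rewrite /=.
Qed.

Lemma walk1 x y : walk e 1 x y = e x y.
Proof.
apply/existsP/idP => [[p]|xy]; last by exists [tuple y]; rewrite /= xy eqxx.
by case/tupleP: p => z p; rewrite tuple0 /= andbT => /andP[xz /eqP <-].
Qed.

Variant gdist_spec x y : option nat -> Type :=
| GdistSome d of walk e d x y & (forall k, walk e k x y -> (d <= k)%N) :
    gdist_spec x y (Some d)
| GdistNone of (forall k, ~~ walk e k x y) : gdist_spec x y None.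

Lemma gdistP x y : gdist_spec x y (gdist e x y).
Proof.
rewrite /gdist; case: {-}_ / (@idP (connect e x y)) => [xy|nxy].
  by case: ex_minnP => d; constructor.
constructor=> k; apply/negP => /existsP[p /andP[xp /eqP yE]].
by apply: nxy; apply/connectP; exists p.
Qed.

Lemma gdist_le1 x y : gdist_le e x y 1 = (y == x) || e x y.
Proof.
rewrite /gdist_le -walk1 eq_sym -walk0; case: gdistP => [d xy dmin|nw].
  apply/idP/orP => [|[]/dmin //]; last by move/leq_trans; apply.
  by case: d xy {dmin} => [|[|//]] xy _; [left|right].
by rewrite !(negbTE (nw _)).
Qed.

Lemma in_starE x y : (y \in star e x) = (y == x) || e x y.
Proof. by rewrite inE gdist_le1. Qed.

Lemma in_linkE x y : irreflexive e -> (y \in link e x) = e x y.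
Proof.
move=> e_irr; rewrite inE -walk1; case: gdistP => [d xy dmin|nw]; last first.
  by rewrite (negbTE (nw _)).
apply/eqP/idP => [[<- //]|xy1]; congr Some; apply/eqP.
rewrite eqn_leq dmin //; case: d xy {dmin} => //; rewrite walk0 => /eqP xy.
by rewrite walk1 xy e_irr in xy1.
Qed.

(** Components are handled below as the least closed sets containing a given vertex, so that later
    arguments need no paths. *)
Definition closed_in (A J : {set T}) :=
  forall x y, x \in J -> y \in A -> e x y -> y \in J.

Lemma componentsP (A K : {set T}) : symmetric e -> K \in components e A ->
  exists2 x, x \in K & K \subset A /\ closed_in A K /\
    forall J : {set T}, J \subset A -> closed_in A J -> x \in J -> K \subset J.
Proof.
move=> e_sym /imsetP[x xA KE]; exists x; first by rewrite KE inE xA connect0.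
split; first by apply/fintype.subsetP => y; rewrite KE inE => /andP[].
split=> [y z|J JA Jcl xJ].
  rewrite KE !inE => /andP[yA xy] zA yz; rewrite zA.
  by apply: connect_trans xy (connect1 _); rewrite /= yA zA.
apply/fintype.subsetP => y; rewrite KE inE => /andP[_ /connectP[p pP ->]].
elim: p x xJ pP {xA KE} => [//|z p IH] x xJ /= /andP[/and3P[_ zA xz]].
by apply: IH; apply: Jcl xz.
Qed.

Lemma components_at (A : {set T}) x : symmetric e -> x \in A ->
  exists2 K, K \in components e A & x \in K /\
    forall J : {set T}, J \subset A -> closed_in A J -> x \in J -> K \subset J.
Proof.
move=> e_sym xA.
exists [set y in A | connect [rel x y | [&& x \in A, y \in A & e x y]] x y].
  by apply/imsetP; exists x.
split=> [|J JA Jcl xJ]; first by rewrite inE xA connect0.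
apply/fintype.subsetP => y; rewrite inE => /andP[_ /connectP[p pP ->]].
elim: p x xJ pP {xA} => [//|z p IH] x xJ /= /andP[/and3P[_ zA xz]].
by apply: IH; apply: Jcl xz.
Qed.

End GraphTheory.

(** * Graph products *)

Section GraphProductTheory.
Variables (N : nat) (e : rel 'I_N) (m : 'I_N -> nat).
Hypotheses (e_sym : symmetric e) (e_irr : irreflexive e).
Hypothesis m_gt1 : forall i, 1 < m i.

Local Notation W := (graph_product e m).
Local Notation v := (vtx e m).

Lemma vtxX_order i : v i ^+ m i = 1.
Proof.
have := word_eq_rel [::] [::] (graph_product_torsion e m i).
rewrite cats0 /= => /presented_classP; rewrite presented_class_nil => <-.
elim: (m i) => [|n IH]; first by [].
by rewrite expgS IH /= presented_class_cons.
Qed.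

Lemma vtx_commute j k : e j k -> commute (v j) (v k).
Proof.
move=> jk; have := word_eq_rel [::] [::] (graph_product_comm m jk).
by move/presented_classP; rewrite /= !presented_class_cons !presented_class_nil !mulg1.
Qed.

Lemma vtxV i : (v i)^-1 = v i ^+ (m i).-1.
Proof.
apply: mulg1_eq; rewrite -expgS prednK ?vtxX_order //.
exact: ltnW.
Qed.

(** Modulo [m i], the exponent sum of the letter [i] depends only on the element. An inverse letter
    counts as [(m i).-1], which keeps the sum in the naturals. *)
Lemma vtx_neq1 i : v i != 1.
Proof.
pose c (a : 'I_N * bool) := if a.1 == i then (if a.2 then 1 else (m i).-1)%N else 0%N.
pose cnt (u : word 'I_N) := (\sum_(a <- u) c a)%N.
have m0 : 0 < m i by exact: ltnW.
have cntP u w : word_eq (graph_product_rel e m) u w -> cnt u = cnt w %[mod m i]%N.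
  elim=> {u w} [//|u w _ -> //|u w x _ -> _ -> //|u a w|u l r w Rlr].
    rewrite /cnt !big_cat /= big_cons big_seq1 /=; apply/eqP.
    rewrite eqn_modDl -[X in _ == X %[mod _]%N]add0n eqn_modDr.
    rewrite /c; case: a => x [] /=; case: (x == i) => //=.
      by rewrite add1n prednK // modnn mod0n.
    by rewrite addn1 prednK // modnn mod0n.
  rewrite /cnt !big_cat /=; apply/eqP.
  rewrite eqn_modDl eqn_modDr; apply/eqP; case: Rlr => [j|j k jk].
    rewrite big_nil; have -> : (\sum_(a <- nseq (m j) (j, true)) c a = m j * (j == i))%N.
      elim: (m j) => [|n IH]; first by rewrite big_nil.
      by rewrite /= big_cons IH mulSn /c /=; case: (j == i).
    by case: eqP => [->|]; rewrite ?muln1 ?muln0 // modnn mod0n.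
  by rewrite !big_cons !big_nil !addn0 addnC.
apply/eqP => /presented_classP/cntP.
by rewrite /cnt big_seq1 big_nil /c /= eqxx !modn_small.
Qed.

Lemma vtx_ind (P : W -> Prop) :
  P 1 -> (forall x k, P x -> P (x * v k)) -> forall x, P x.
Proof.
move=> P1 PM x; rewrite -[x]presented_reprK.
elim/last_ind: (repr x) => [//|u a IH].
have PX y k n : P y -> P (y * v k ^+ n).
  by move=> Py; elim: n => [|n Pn]; rewrite ?mulg1 // expgSr mulgA; apply: PM.
rewrite -cats1 presented_class_cat presented_class_letter /letter_val.
case: a => k [] /=; first exact: PM.
by rewrite -/(v k) vtxV; apply: PX.
Qed.

Lemma vtx_hom_eq (G : groupType) (f g : W -> G) :
  {morph f : x y / x * y} -> {morph g : x y / x * y} ->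
  (forall k, f (v k) = g (v k)) -> f =1 g.
Proof.
move=> fM gM fg; elim/vtx_ind => [|x k IH]; last by rewrite fM gM IH fg.
have h1 (h : W -> G) : {morph h : x y / x * y} -> h 1 = 1.
  by move=> hM; apply: (mulgI (h 1)); rewrite -hM !mulg1.
by rewrite !h1.
Qed.

Lemma vtx_aut_eq (f g : aut W) : (forall k, f (v k) = g (v k)) -> f = g.
Proof. by move=> fg; apply: aut_eqP; apply: vtx_hom_eq fg; apply: autM. Qed.

(** * Star subgroups, the centralizers of the generators *)

Definition in_star i k := (k == i) || e i k.

Lemma in_star_sym i k : in_star i k = in_star k i.
Proof. by rewrite /in_star eq_sym e_sym. Qed.

Lemma in_star_refl i : in_star i i. Proof. by rewrite /in_star eqxx. Qed.

Lemma in_star_commute i k : in_star i k -> commute (v k) (v i).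
Proof. by case/orP => [/eqP-> //|ik]; apply/commute_sym/vtx_commute. Qed.

(** The subgroup generated by the star of [i]; positive words suffice since generators have finite
    order. It is the centralizer of [v i], by [par_commute] and [centralizer_par], and its left
    cosets are the walls of type [i]. *)
Definition par i (x : W) : bool :=
  `[< exists s, all (in_star i) s /\ x = \prod_(k <- s) v k >].

Lemma par1 i : par i 1.
Proof. by apply/asboolP; exists [::]; rewrite big_nil. Qed.

Lemma parM i x y : par i x -> par i y -> par i (x * y).
Proof.
move=> /asboolP[s [sP ->]] /asboolP[t [tP ->]]; apply/asboolP.
by exists (s ++ t); rewrite all_cat sP tP big_cat.
Qed.

Lemma par_vtx i k : in_star i k -> par i (v k).
Proof. by move=> ik; apply/asboolP; exists [:: k]; rewrite /= ik big_seq1. Qed.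

Lemma parX i x n : par i x -> par i (x ^+ n).
Proof.
by move=> ix; elim: n => [|n IH]; rewrite ?par1 // expgS parM.
Qed.

Lemma par_ind i (P : W -> Prop) :
  P 1 -> (forall x k, in_star i k -> par i x -> P x -> P (x * v k)) ->
  forall x, par i x -> P x.
Proof.
move=> P1 PM x /asboolP[s [sP ->]]; elim/last_ind: s sP => [|s k IH].
  by rewrite big_nil.
rewrite all_rcons => /andP[ik sP]; rewrite -cats1 big_cat big_seq1 /=.
by apply: PM => //; [apply/asboolP; exists s|apply: IH].
Qed.

Lemma parV i x : par i x^-1 = par i x.
Proof.
suff {x} PV x : par i x -> par i x^-1.
  by apply/idP/idP => [/PV|/PV //]; rewrite invgK.
elim/par_ind => [|{}x k ik _ IH]; first by rewrite invg1 par1.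
by rewrite invgM parM // vtxV parX // par_vtx.
Qed.

Lemma par_mulr i x y : par i y -> par i (x * y) = par i x.
Proof.
move=> py; apply/idP/idP => [pxy|px]; last exact: parM.
by rewrite -(mulgK y x) parM // parV.
Qed.

Lemma par_mull i x y : par i y -> par i (y * x) = par i x.
Proof.
move=> py; apply/idP/idP => [pxy|px]; last exact: parM.
by rewrite -(mulKg y x) parM // parV.
Qed.

Lemma par_commute i x : par i x -> commute x (v i).
Proof.
elim/par_ind => [|{}x k ik _ IH]; first exact/commute_sym/commute1.
by apply/commute_sym/commuteM; apply/commute_sym => //; apply: in_star_commute.
Qed.

(** * Sides of a wall *)

(* The rotation about the wall [par i] performed by the gallery of [W] that
   starts at [x] and spells the word [u]. *)
Fixpoint proj_word i (x : W) (u : word 'I_N) : W :=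
  if u is a :: u' then
    (if (a.1 == i) && par i x then letter_val v a else 1)
      * proj_word i (x * letter_val v a) u'
  else 1.

Lemma proj_word_cat i x u w :
  proj_word i x (u ++ w) =
  proj_word i x u * proj_word i (x * word_val v u) w.
Proof.
elim: u x => [|a u IH] x /=; first by rewrite /word_val big_nil !gsimp.
by rewrite IH /word_val big_cons !mulgA.
Qed.

Lemma par_letter i x b : par i (x * letter_val v (i, b)) = par i x.
Proof.
by apply: par_mulr; case: b; rewrite /letter_val /= ?parV par_vtx // in_star_refl.
Qed.

Lemma word_val_vtxE u : word_val v u = presented_class _ u :> W.
Proof.
elim: u => [|a u IH]; first by rewrite /word_val big_nil.
by rewrite presented_class_cons -IH /word_val big_cons.
Qed.

(** A letter [i] counts only inside [par i], and star letters do not change membership in [par i].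
    So a torsion relator counts all its letters or none, and swapping [i] with a neighbour does not
    affect its count. *)
Lemma proj_word_eq i x u w :
  word_eq (graph_product_rel e m) u w -> proj_word i x u = proj_word i x w.
Proof.
move=> uw; elim: uw x => {u w} [//|u w _ IH x|u w y _ IH1 _ IH2 x|u a w x|u l r w Rlr x].
- by rewrite IH.
- by rewrite IH1.
- have aV : word_val v [:: a; inv_letter a] = 1 :> W.
    by rewrite /word_val big_cons big_seq1 letter_val_inv mulgV.
  have paV z : proj_word i z [:: a; inv_letter a] = 1.
    rewrite /= letter_val_inv mulg1; case: a {aV} => k b /=.
    case: eqP => [->|_] /=; last by rewrite mulg1.
    by rewrite par_letter; case: par; rewrite ?mulgV ?mulg1.
  by rewrite !proj_word_cat aV paV mul1g mulg1.
have lr : word_val v l = word_val v r :> W.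
  rewrite !word_val_vtxE; apply/presented_classP.
  by have := word_eq_rel [::] [::] Rlr; rewrite !cats0.
rewrite !proj_word_cat lr; congr (_ * (_ * _)); set z := x * _.
case: Rlr {lr} => [j|j k jk] /=.
  have [<-{i}|ji] := eqVneq j i; last first.
    by elim: (m j) z => [//|n IH] z /=; rewrite (negbTE ji) mul1g IH.
  have -> : proj_word j z (nseq (m j) (j, true)) = (if par j z then v j else 1) ^+ m j.
    elim: (m j) z => [//|n IH] z /=.
    by rewrite eqxx /= IH par_letter expgS.
  by case: ifP => _; rewrite ?vtxX_order // expg1n.
rewrite !mulg1 /letter_val /=.
have [ji|_] := eqVneq j i; have [ki|_] := eqVneq k i => //=.
- by rewrite ji ki e_irr in jk.
- by rewrite mulg1 mul1g par_mulr // par_vtx // -ji /in_star jk orbT.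
by rewrite mulg1 mul1g par_mulr // par_vtx // -ki /in_star e_sym jk orbT.
Qed.

(* The initial [v i]-syllable of [x]: the gate of [x] in the residue of [1] of
   type [i] of the right-angled building of [W]. *)
Definition proj i (x : W) : W := proj_word i 1 (repr x).

Lemma proj1 i : proj i 1 = 1.
Proof. exact: (proj_word_eq i 1 (repr_presented_class _ [::])). Qed.

Lemma proj_mul_vtx i x k :
  proj i (x * v k) = proj i x * (if (k == i) && par i x then v i else 1).
Proof.
rewrite /proj.
have -> : proj_word i 1 (repr (x * v k)) = proj_word i 1 (repr x ++ [:: (k, true)]).
  apply: proj_word_eq; rewrite -{1}[x]presented_reprK.
  by rewrite -presented_class_cat; apply: repr_presented_class.
rewrite proj_word_cat /= mul1g word_val_vtxE presented_reprK mulg1.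
by rewrite /letter_val /=; case: eqP => [->|].
Qed.

Lemma proj_notpar i x n : ~~ par i x -> proj i (x * v i ^+ n) = proj i x.
Proof.
move=> nx; elim: n => [|n IH]; first by rewrite mulg1.
rewrite expgSr mulgA proj_mul_vtx IH par_mulr ?parX ?par_vtx ?in_star_refl //.
by rewrite (negbTE nx) andbF mulg1.
Qed.

Lemma proj_mulX i x k n :
  proj i (x * v k ^+ n) = proj i x * (if (k == i) && par i x then v i ^+ n else 1).
Proof.
elim: n => [|n IH]; first by rewrite !mulg1 if_same mulg1.
rewrite expgSr mulgA proj_mul_vtx IH.
have [->|] /= := eqVneq k i; last by rewrite !mulg1.
rewrite par_mulr ?parX ?par_vtx ?in_star_refl //.
by case: par; rewrite -?mulgA -?expgSr ?mulg1.
Qed.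

Lemma proj_parM i h x : par i h -> proj i (h * x) = proj i h * proj i x.
Proof.
move=> ph; elim/vtx_ind: x => [|x k IH]; first by rewrite proj1 !mulg1.
by rewrite mulgA !proj_mul_vtx par_mull // IH mulgA.
Qed.

Lemma proj_vtxX i k n : proj i (v k ^+ n) = if k == i then v i ^+ n else 1.
Proof. by rewrite -[_ ^+ n]mul1g proj_mulX proj1 mul1g par1 andbT. Qed.

Lemma proj_vtxXM i n x : proj i (v i ^+ n * x) = v i ^+ n * proj i x.
Proof. by rewrite proj_parM ?proj_vtxX ?eqxx // parX ?par_vtx ?in_star_refl. Qed.

Lemma proj_adjM i k n x : e i k -> proj i (v k ^+ n * x) = proj i x.
Proof.
move=> ik; rewrite proj_parM ?parX ?par_vtx /in_star ?ik ?orbT //.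
rewrite proj_vtxX; case: eqP => [ki|]; last by rewrite mul1g.
by rewrite ki e_irr in ik.
Qed.

Lemma proj_par_out i j h : par i h -> ~~ in_star i j -> proj j h = 1.
Proof.
move=> + nij; elim/par_ind => [|{}h k ik _ IH]; first exact: proj1.
rewrite proj_mul_vtx IH mul1g; case: eqP => // kj.
by rewrite -kj ik in nij.
Qed.

Lemma proj_exists i x : exists n, proj i x = v i ^+ n.
Proof.
elim/vtx_ind: x => [|x k [n IH]]; first by exists 0%N; rewrite proj1.
rewrite proj_mul_vtx IH; case: ifP => _; last by exists n; rewrite mulg1.
by exists n.+1; rewrite expgSr.
Qed.

Lemma projV_exists i x : exists n, (proj i x)^-1 = v i ^+ n.
Proof.
have [n ->] := proj_exists i x; exists (n * (m i).-1)%N.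
by rewrite mulnC expgnA -vtxV expVgn.
Qed.

Lemma proj_projVM i x : proj i ((proj i x)^-1 * x) = 1.
Proof.
by have [n E] := projV_exists i x; rewrite E proj_vtxXM -E mulVg.
Qed.

(** Off [par i], right multiplication by [v i] leaves [proj i] unchanged, while left multiplication
    always multiplies it by [v i]. *)
Lemma centralizer_par i h : commute h (v i) -> par i h.
Proof.
move=> hi; apply: contraT => nh; case/eqP: (vtx_neq1 i).
have := proj_vtxXM i 1 h; rewrite expg1 -hi (proj_notpar 1 nh).
by rewrite -[LHS]mul1g => /mulIg.
Qed.

Lemma proj_mul_par i j x y : ~~ in_star i j \/ i = j /\ ~~ par i x ->
  par j y -> proj i (x * y) = proj i x.
Proof.
case=> [ni|[-> np]]; elim/par_ind => [|{}y k jk py IH]; rewrite ?mulg1 //.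
  rewrite mulgA proj_mul_vtx IH; case: eqP => [ki|]; last by rewrite mulg1.
  by rewrite in_star_sym -ki jk in ni.
by rewrite mulgA proj_mul_vtx IH par_mulr // (negbTE np) andbF mulg1.
Qed.

(* Walls of non-adjacent types, and distinct walls of the same type, do not
   cross: any chamber lies, with respect to one of them, on the side of the
   other one. *)
Lemma proj_disjoint_walls i j g h x :
  ~~ in_star i j \/ i = j /\ ~~ par i (g^-1 * h) ->
  proj i (g^-1 * x) = proj i (g^-1 * h) \/ proj j (h^-1 * x) = proj j (h^-1 * g).
Proof.
have const g' h' i' j' y : ~~ in_star i' j' \/ i' = j' /\ ~~ par i' (g'^-1 * h') ->
    par j' (h'^-1 * y) -> proj i' (g'^-1 * y) = proj i' (g'^-1 * h').
  move=> D /(proj_mul_par D) <-; congr proj.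
  by rewrite -mulgA mulVKg.
move=> Dij.
have Dji : ~~ in_star j i \/ j = i /\ ~~ par j (h^-1 * g).
  case: Dij => [|[-> np]]; first by rewrite in_star_sym; left.
  by right; split=> //; rewrite -parV invgM invgK.
suff Dx y : proj i (g^-1 * (h * y)) = proj i (g^-1 * h) \/
            proj j (h^-1 * (h * y)) = proj j (h^-1 * g).
  by have := Dx (h^-1 * x); rewrite mulVKg.
(* A gallery starts at [h], where the first alternative holds. A step across the wall of [g] stays
   in the coset [g par i], which lies on one side of the wall of [h]; likewise with the roles
   exchanged. *)
elim/vtx_ind: y => [|y k IH]; first by left; rewrite mulg1.
rewrite !mulgA !proj_mul_vtx -!mulgA.
have [/andP[/eqP-> pi]|_] := boolP (_ && par i _).
  right; have := const h g j i (h * (y * v i)) Dji.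
  rewrite !mulgA proj_mul_vtx -!mulgA; apply.
  by rewrite !mulgA par_mulr ?par_vtx ?in_star_refl // -!mulgA.
have [/andP[_ pj]|_] := boolP (_ && par j _); last by rewrite !mulg1.
left; rewrite mulg1; apply: const Dij _.
exact: pj.
Qed.

(** * Syllable length *)

Definition sylprod (s : seq ('I_N * nat)) : W := \prod_(t <- s) v t.1 ^+ t.2.

Lemma sylprod_rcons s t : sylprod (rcons s t) = sylprod s * v t.1 ^+ t.2.
Proof. by rewrite /sylprod -cats1 big_cat big_seq1. Qed.

Lemma len_subproof x : exists n, `[< exists2 s, size s = n & x = sylprod s >].
Proof.
suff [s ->] : exists s, x = sylprod s.
  by exists (size s); apply/asboolP; exists s.
elim/vtx_ind: x => [|x k [s ->]]; first by exists [::]; rewrite /sylprod big_nil.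
by exists (rcons s (k, 1%N)); rewrite sylprod_rcons.
Qed.

(** Syllable length rather than word length: any power of one generator costs one step, as does one
    wall crossing. *)
Definition len (x : W) : nat := ex_minn (len_subproof x).

Lemma len_sylprod x : exists2 s, size s = len x & x = sylprod s.
Proof. by rewrite /len; case: ex_minnP => n /asboolP. Qed.

Lemma len_leq s : (len (sylprod s) <= size s)%N.
Proof.
by rewrite /len; case: ex_minnP => n _; apply; apply/asboolP; exists s.
Qed.

Lemma len1 : len 1 = 0%N.
Proof.
have := len_leq [::]; rewrite /sylprod big_nil.
by rewrite leqn0 => /eqP.
Qed.

Lemma len_mulr x k n : (len (x * v k ^+ n) <= (len x).+1)%N.
Proof.
have [s <- {1}->] := len_sylprod x; have := len_leq (rcons s (k, n)).
by rewrite sylprod_rcons size_rcons.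
Qed.

Lemma lenV x : len x^-1 = len x.
Proof.
suff {x} leV x : (len x^-1 <= len x)%N.
  by apply/eqP; rewrite eqn_leq leV -{1}[x]invgK leV.
have [s <- {1}->] := len_sylprod x; rewrite /sylprod -{1}[s]revK -prodgV.
have -> : \prod_(t <- rev s) (v t.1 ^+ t.2)^-1 =
          sylprod [seq (t.1, t.2 * (m t.1).-1)%N | t <- rev s].
  rewrite /sylprod big_map; apply: eq_bigr => t _.
  by rewrite /= mulnC expgnA -vtxV expVgn.
by rewrite (leq_trans (len_leq _)) // size_map size_rev.
Qed.

Lemma len_mull x k n : (len (v k ^+ n * x) <= (len x).+1)%N.
Proof.
have [s <- {1}->] := len_sylprod x; have := len_leq ((k, n) :: s).
by rewrite {1}/sylprod big_cons.
Qed.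

(* Folding at the wall [g par i] the sectors onto the one of the chamber [1]
   shortens galleries. *)
Lemma len_fold i g x : proj i g^-1 = 1 ->
  (len (g * (proj i (g^-1 * x))^-1 * g^-1 * x)%g +
   (proj i (g^-1 * x)%g != 1%g) <= len x)%N.
Proof.
move=> g1; have [s <- ->] := len_sylprod x.
elim/last_ind: s {x} => [|s [k a] IH].
  by rewrite /sylprod big_nil !mulg1 g1 invg1 mulg1 mulgV len1 eqxx.
rewrite sylprod_rcons size_rcons /=; move: (sylprod s) IH => y IH.
rewrite [g^-1 * (y * _)]mulgA proj_mulX.
(* A syllable performed on the wall is undone by the fold, and its disappearance pays for the extra
   1. Any other syllable lengthens both sides alike and leaves the side of the wall unchanged. *)
have [/andP[/eqP-> py]|_] := boolP (_ && par i _).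
  suff -> : g * (proj i (g^-1 * y) * v i ^+ a)^-1 * g^-1 * (y * v i ^+ a) =
            g * (proj i (g^-1 * y))^-1 * g^-1 * y.
    by rewrite -addn1 leq_add ?leq_b1 // (leq_trans _ IH) // leq_addr.
  have yC : commute (g^-1 * y) (v i ^+ a) by apply/commuteX/par_commute.
  have [n ->] := proj_exists i (g^-1 * y).
  rewrite -expgnDr addnC expgnDr invgM -!mulgA; congr (g * (_ * _)).
  by rewrite [g^-1 * _]mulgA yC mulKg.
rewrite mulg1 mulgA; apply: leq_trans (leq_add (len_mulr _ _ _) (leqnn _)) _.
by rewrite addSn ltnS.
Qed.

Lemma len_projV i x : proj i x != 1 -> (len ((proj i x)^-1 * x)%g < len x)%N.
Proof.
move=> px; have := @len_fold i 1 x; rewrite invg1 !mul1g mulg1 px addn1.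
by apply; exact: proj1.
Qed.

(** The first syllable of a shortest expression works: if [proj k y] cancelled it, [x] would be a
    fold of the shorter [y]. *)
Lemma proj_neq1 x : x != 1 -> exists k, proj k x != 1.
Proof.
move=> x1; have [[|[k a] s] sx xE] := len_sylprod x.
  by rewrite xE /sylprod big_nil eqxx in x1.
exists k; set y := sylprod s.
have {}xE : x = v k ^+ a * y by rewrite xE /sylprod big_cons.
have lt_yx : (len y < len x)%N by rewrite -sx ltnS len_leq.
apply: contraL lt_yx => /eqP; rewrite xE proj_vtxXM => pk; rewrite -leqNgt.
have aE : v k ^+ a = (proj k y)^-1 by apply/eqP; rewrite -mulg_eq1 pk.
rewrite aE; have [->|py] := eqVneq (proj k y) 1; first by rewrite invg1 mul1g.
exact/ltnW/len_projV.
Qed.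

Lemma proj_excl i k x : ~~ in_star i k -> proj i x != 1 -> proj k x = 1.
Proof.
move=> nik px; have := @proj_disjoint_walls i k 1 1 x (or_introl nik).
by rewrite invg1 !mul1g !proj1 => -[p1|//]; rewrite p1 eqxx in px.
Qed.

(** * Torsion *)

(** Peeling off an initial syllable of type [k] leaves an element of [par k], whose initial types
    are adjacent to [k] and were already initial in [x]. So the set of initial types shrinks at each
    step. *)
Lemma len_card_proj x : (forall i, proj i x != 1 -> par i x) ->
  (len x <= #|[set i | proj i x != 1%g]|)%N.
Proof.
have [n] := ubnP #|[set i | proj i x != 1]|; elim: n x => // n IH x.
rewrite ltnS => le_n parx.
have [->|x1] := eqVneq x 1; first by rewrite len1.
have [k pk] := proj_neq1 x1.
have [a aE] := proj_exists k x; pose y := (proj k x)^-1 * x.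
have xE : x = v k ^+ a * y by rewrite -aE mulVKg.
have pky : proj k y = 1 by exact: proj_projVM.
have pary : par k y.
  have := parx _ pk; rewrite {1}xE par_mull //.
  by rewrite parX // par_vtx // in_star_refl.
have sub i : proj i y != 1 -> [/\ i != k, e i k & proj i x = proj i y].
  move=> pi; have ik : i != k by apply: contraNneq pi => ->; apply/eqP.
  have eik : e i k.
    move/negPf: ik => ik; apply: contraR pi => nik; apply/eqP.
    by rewrite (proj_par_out pary) // in_star_sym /in_star eq_sym ik.
  by split=> //; rewrite xE proj_adjM.
have lt_card : (#|[set i | proj i y != 1%g]| < #|[set i | proj i x != 1%g]|)%N.
  apply: proper_card; apply/properP; split; last first.
    by exists k; rewrite inE // pky eqxx.
  by apply/fintype.subsetP => i; rewrite !inE => /[dup] /sub[_ _ ->].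
rewrite xE (leq_trans (len_mull _ _ _)) // -xE (leq_trans _ lt_card) // ltnS.
apply: IH; first exact: leq_trans lt_card le_n.
move=> i /[dup] /sub[_ eik pE]; rewrite -pE => /parx.
by rewrite {1}xE par_mull // parX // par_vtx // /in_star eik orbT.
Qed.

(** Suppose [x] is off [par i]. If it begins with a syllable [s] and ends with its inverse,
    conjugation cancels both, against minimality. Otherwise the disjoint walls [par i] and [x par i]
    force every positive power to keep the initial syllable of [x]. *)
Lemma torsion_par i x n : (forall g, len x <= len (g * x * g^-1)%g)%N ->
  x ^+ n.+1 = 1 -> proj i x != 1 -> par i x.
Proof.
move=> xmin xn px; apply: contraT => npx.
have [pV|pV] := eqVneq (proj i x^-1) (proj i x).
  have [a aE] := projV_exists i x; have [b bE] := proj_exists i x.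
  have := xmin (proj i x)^-1; rewrite invgK leqNgt => /negP[].
  apply: leq_trans (len_projV px); rewrite ltnS ltnW //.
  set y := _ * x; rewrite -lenV -[X in (_ < X)%N]lenV invgM.
  have -> : proj i x = proj i y^-1.
    by rewrite invgM invgK bE proj_notpar ?parV // pV.
  apply: len_projV.
  by rewrite invgM invgK bE proj_notpar ?parV // pV.
have : proj i (x ^+ n.+1) = proj i x.
  elim: n {xn} => [//|n IH]; rewrite expgS.
  have := @proj_disjoint_walls i i 1 x (x * x ^+ n.+1).
  rewrite invg1 !mul1g mulKg mulg1 => -[|//|]; first by right.
  by rewrite IH => /esym pE; rewrite pE eqxx in pV.
by rewrite xn proj1 => p1; rewrite -p1 eqxx in px.
Qed.

Lemma torsion_conj x n : x ^+ n.+1 = 1 -> exists g, (len (g * x * g^-1)%g <= N)%N.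
Proof.
move=> xn; pose P l := `[< exists g, len (g * x * g^-1) = l >].
have exP : exists l, P l by exists (len (1 * x * 1^-1)); apply/asboolP; exists 1.
case: (ex_minnP exP) => l /asboolP[g gl] lmin; exists g.
rewrite -[N in (_ <= N)%N]card_ord; apply: leq_trans (max_card _).
apply: len_card_proj => i; apply: (@torsion_par _ _ n) => [h|].
  rewrite gl; apply: lmin; apply/asboolP; exists (h * g).
  by rewrite invgM !mulgA.
by rewrite -innE -autX xn aut1.
Qed.

(** * Conjugating automorphisms *)

(** The conjugate of [v k] preserves the coset [g par j]. If that coset missed [h par k], it would
    lie in a single sector of this wall, yet the conjugate moves every sector to another one. *)
Lemma commuting_walls_meet j k g h :
  commute (g * v j * g^-1) (h * v k * h^-1) ->
  exists z, par j (g^-1 * z) /\ par k (h^-1 * z).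
Proof.
move=> C; apply: contrapT => nz.
pose q := g^-1 * (h * v k * h^-1) * g.
have pq : par j q.
  apply: centralizer_par; move: C; rewrite /commute /q.
  move/(congr1 (fun x => g^-1 * x * g)); rewrite !mulgA !mulgVK mulVg mul1g.
  by move=> <-.
have npar y : par j y -> ~~ par k (h^-1 * (g * y)).
  by move=> py; apply/negP => pk; apply: nz; exists (g * y); rewrite mulKg.
have const y : par j y -> proj k (h^-1 * (g * y)) = proj k (h^-1 * g).
  elim/par_ind => [|{}y l jl py IH]; first by rewrite mulg1.
  by rewrite !mulgA proj_mul_vtx -!mulgA (negbTE (npar _ py)) andbF mulg1 IH.
have qE : h^-1 * (g * q) = v k ^+ 1 * (h^-1 * g).
  by rewrite /q !mulgA mulgK mulVg mul1g.
have := const _ pq; rewrite qE proj_vtxXM -[RHS]mul1g => /mulIg/eqP.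
by rewrite expg1 (negbTE (vtx_neq1 k)).
Qed.

(** At a common chamber [z] of the two walls the conjugate of [v k] becomes [v k] itself, which lies
    in [par i] and has no [i]-syllable. *)
Lemma proj_conj_adj i k g h n x : e i k ->
  commute (g * v i * g^-1) (h * v k * h^-1) ->
  proj i (g^-1 * ((h * v k * h^-1) ^+ n * x)) = proj i (g^-1 * x).
Proof.
move=> ik /commuting_walls_meet[z [pg ph]].
have -> : h * v k * h^-1 = z * v k * z^-1.
  have := par_commute ph; rewrite /commute => hz.
  have -> : z * v k = h * (h^-1 * z * v k) by rewrite !mulgA mulgV mul1g.
  by rewrite hz !mulgA mulgK.
rewrite -innE -autX innE.
have -> : g^-1 * (z * v k ^+ n * z^-1 * x) = g^-1 * z * (v k ^+ n * (z^-1 * x)).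
  by rewrite !mulgA.
by rewrite proj_parM // proj_adjM // -proj_parM // -!mulgA mulVKg.
Qed.

Section ConjugatingAutomorphism.
Variables (f : aut W) (g : 'I_N -> W).
Hypothesis fE : forall i, f (v i) = g i * v i * (g i)^-1.

Lemma conj_autX i n x : (g i)^-1 * f (v i ^+ n * x) = v i ^+ n * ((g i)^-1 * f x).
Proof.
by rewrite autM autX fE -innE -autX innE -!mulgA mulKg.
Qed.

Lemma conj_aut_adj i k : e i k ->
  commute (g i * v i * (g i)^-1) (g k * v k * (g k)^-1).
Proof. by move=> ik; rewrite -!fE /commute -!autM vtx_commute. Qed.

(* If the chamber [1] and every wall [g j P_j] lie on the same side of every
   wall [g i P_i], then [f] preserves the sectors; since [f] is onto, the
   chambers adjacent to [1] are cut off by the walls [g i P_i] themselves. *)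
Lemma conj_aut_rigid : (forall i, proj i (g i)^-1 = 1) ->
  (forall i j, ~~ in_star i j -> proj i ((g i)^-1 * g j) = 1) -> f = 1.
Proof.
move=> g1 gg.
have pE y i : proj i ((g i)^-1 * f y) = proj i y.
  have [n] := ubnP (len y); elim: n y i => // n IH y i; rewrite ltnS => le_n.
  have [->|y1] := eqVneq y 1; first by rewrite aut1 mulg1 g1 proj1.
  have [k pk] := proj_neq1 y1; have lt_n := leq_trans (len_projV pk) le_n.
  have [a aE] := proj_exists k y; set y' := (_ * y)%g in lt_n.
  have yE : y = v k ^+ a * y' by rewrite -aE mulVKg.
  have [->|ik] := eqVneq i k; first by rewrite yE conj_autX !proj_vtxXM IH.
  have [eik|nik] := boolP (e i k).
    rewrite yE proj_adjM // autM autX fE proj_conj_adj ?IH //.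
    exact: conj_aut_adj.
  have nst : ~~ in_star i k by rewrite /in_star eq_sym (negbTE ik).
  (* By induction the wall of [k] separates [f y] from the wall of [i]. Hence [f y] lies, for the
     wall of [i], on the side of the wall of [k], which is the side of 1. *)
  have nst' : ~~ in_star k i by rewrite in_star_sym.
  rewrite [RHS](proj_excl nst' pk) -(gg _ _ nst).
  have := @proj_disjoint_walls i k (g i) (g k) (f y) (or_introl nst); case=> [-> //|].
  rewrite gg // {1}yE conj_autX proj_vtxXM IH // -proj_vtxXM -yE => p1.
  by rewrite p1 eqxx in pk.
apply: vtx_aut_eq => k; rewrite fE aut_oneE.
suff pk : par k (g k).
  by rewrite (par_commute pk) mulgK.
(* Some wall of a conjugator [g i] separates 1 from [v k]. These chambers being adjacent, the wall
   passes through 1 and [i] is [k]. *)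
have y1 : f^-1 (v k) != 1.
  apply: contraNneq (vtx_neq1 k) => y1.
  by rewrite -(aut_KV f (v k)) y1 aut1.
have [i] := proj_neq1 y1; rewrite -pE aut_KV proj_mul_vtx g1 mul1g.
by case: ifP => [/andP[/eqP-> ]|]; rewrite ?parV // eqxx.
Qed.

End ConjugatingAutomorphism.

(** * Partial conjugations *)

(** These are the unions of components outside the star of [i]; complements and peak reduction
    produce unions rather than single components. *)
Definition star_closed i (J : {set 'I_N}) : Prop :=
  J \subset ~: star e i /\ closed_in e (~: star e i) J.

Lemma in_starCE i j : (j \in ~: star e i) = ~~ in_star i j.
Proof. by rewrite inE in_starE. Qed.

Lemma star_closed_sub i J j : star_closed i J -> j \in J -> ~~ in_star i j.
Proof. by case=> /fintype.subsetP JS _ /JS; rewrite in_starCE. Qed.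

Lemma star_closed_adj i J j k : star_closed i J -> j \in J -> e j k ->
  k \notin J -> in_star i k.
Proof.
case=> _ Jcl jJ jk; apply: contraR => nk; apply: Jcl jk => //.
by rewrite in_starCE.
Qed.

Lemma star_closed_notin i J : star_closed i J -> i \notin J.
Proof.
by move=> Jcl; apply/negP => /(star_closed_sub Jcl); rewrite in_star_refl.
Qed.

Lemma star_closed_compl i J : star_closed i J ->
  star_closed i (~: star e i :\: J).
Proof.
move=> Jcl; split; first exact: finset.subsetDl.
move=> x y; rewrite finset.in_setD => /andP[xJ xS] yS xy; rewrite finset.in_setD yS andbT.
apply: contra xJ => yJ; case: Jcl => _ Jcl; apply: (Jcl y) => //.
by rewrite e_sym.
Qed.

Lemma component_star_closed i K : K \in components e (~: star e i) ->
  star_closed i K.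
Proof. by case/componentsP => // x _ [KS [Kcl _]]. Qed.

Definition conj_on i (J : {set 'I_N}) a (f : aut W) : Prop :=
  forall j, f (v j) = if j \in J then v i ^+ a * v j * v i ^- a else v j.

Lemma conj_on_uniq i J a f g : conj_on i J a f -> conj_on i J a g -> f = g.
Proof. by move=> fE gE; apply: vtx_aut_eq => k; rewrite fE gE. Qed.

Lemma partial_conj_on i K f : is_partial_conj i K f -> conj_on i K 1 f.
Proof. by case=> _ fE j; rewrite fE expg1. Qed.

(** An edge leaving [J] ends in the star of [i], which [v i] centralizes, so the relations are
    respected. The exponent [a * (m i).-1] plays the part of [- a] in the inverse. *)
Lemma conj_on_exists i J a : star_closed i J -> exists f, conj_on i J a f.
Proof.
move=> Jcl; have nJ := star_closed_notin Jcl.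
have hom b : exists F : W -> W, {morph F : x y / x * y} /\ forall j,
    F (v j) = if j \in J then v i ^+ b * v j * v i ^- b else v j.
  apply: presented_lift => l r [j|j k jk].
    rewrite word_val_nseq /word_val big_nil.
    case: ifP => _; last exact: vtxX_order.
    by rewrite -innE -autX vtxX_order aut1.
  rewrite /word_val !big_cons !big_nil !mulg1 /letter_val /=.
  have CS k' : in_star i k' -> v i ^+ b * v k' * v i ^- b = v k'.
    move=> /in_star_commute C; have /commute_sym -> := commuteX b C.
    exact: mulgK.
  have Cjk := vtx_commute jk.
  case: ifPn => jJ; case: ifPn => kJ //; first 1 last.
  - by rewrite -(CS _ (star_closed_adj Jcl jJ jk kJ)) -!innE -!autM Cjk.
  - rewrite e_sym in jk.
    by rewrite -(CS _ (star_closed_adj Jcl kJ jk jJ)) -!innE -!autM Cjk.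
  by rewrite -!innE -!autM Cjk.
have [F [FM FE]] := hom a; have [F' [FM' FE']] := hom (a * (m i).-1)%N.
have aV : v i ^+ (a * (m i).-1) = v i ^- a.
  by rewrite mulnC expgnA -vtxV expVgn.
have X1 (h : W -> W) : {morph h : x y / x * y} -> forall x n, h (x ^+ n) = h x ^+ n.
  move=> hM x; elim=> [|n IH]; last by rewrite !expgS hM IH.
  by apply: (mulgI (h 1)); rewrite -hM !mulg1.
have XV (h : W -> W) : {morph h : x y / x * y} -> forall x, h x^-1 = (h x)^-1.
  move=> hM x; apply: (mulgI (h x)); rewrite -hM !mulgV.
  by apply: (mulgI (h 1)); rewrite -hM !mulg1.
have FK : cancel F F'.
  move=> x; apply: (@vtx_hom_eq _ (F' \o F) id) => [y z|//|j] /=.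
    by rewrite FM FM'.
  rewrite FE; case: ifPn => jJ; last by rewrite FE' (negbTE jJ).
  rewrite !FM' (XV _ FM') !(X1 _ FM') !FE' (negbTE nJ) jJ aV invgK !mulgA.
  by rewrite mulgV mul1g mulgK.
have FK' : cancel F' F.
  move=> x; apply: (@vtx_hom_eq _ (F \o F') id) => [y z|//|j] /=.
    by rewrite FM' FM.
  rewrite FE'; case: ifPn => jJ; last by rewrite FE (negbTE jJ).
  rewrite !FM (XV _ FM) !(X1 _ FM) !FE (negbTE nJ) jJ aV invgK !mulgA.
  by rewrite mulVg mul1g mulgVK.
have Faut : is_aut F by apply/asboolP; split=> //; exists F'.
by exists (Aut Faut).
Qed.

Lemma conj_onM i J a b f g : star_closed i J ->
  conj_on i J a f -> conj_on i J b g -> conj_on i J (a + b) (f * g).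
Proof.
move=> /star_closed_notin nJ fE gE j; rewrite aut_mulE gE.
case: ifPn => jJ; last by rewrite fE (negbTE jJ).
rewrite !autM autV autX !fE jJ (negbTE nJ) addnC expgnDr invgM !mulgA.
by [].
Qed.

Lemma conj_onX i J a f n : star_closed i J ->
  conj_on i J a f -> conj_on i J (a * n) (f ^+ n).
Proof.
move=> Jcl fE; elim: n => [|n IH].
  by move=> j; rewrite muln0 mul1g invg1 mulg1 if_same.
by rewrite expgS mulnS; apply: conj_onM.
Qed.

Lemma conj_on_order i J a f : star_closed i J -> conj_on i J a f -> f ^+ m i = 1.
Proof.
move=> Jcl fE; apply: vtx_aut_eq => j; rewrite (conj_onX _ Jcl fE).
by rewrite mulnC expgnA vtxX_order expg1n invg1 mul1g mulg1 if_same.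
Qed.

Lemma conj_on_commute_star i k J L a b f g : in_star i k ->
  star_closed i J -> star_closed k L ->
  conj_on i J a f -> conj_on k L b g -> commute f g.
Proof.
move=> ik Jcl Lcl fE gE; apply: vtx_aut_eq => j; rewrite !aut_mulE fE gE.
have kJ : k \notin J by apply: contraL ik => /(star_closed_sub Jcl).
have iL : i \notin L.
  by apply/negP => /(star_closed_sub Lcl); rewrite in_star_sym ik.
have C : commute (v i ^+ a) (v k ^+ b).
  exact/commuteX2/commute_sym/in_star_commute.
case: ifPn => jL; case: ifPn => jJ; rewrite ?fE ?gE ?autM ?autV ?autX ?fE ?gE
  ?(negbTE kJ) ?(negbTE iL) ?jJ ?jL ?(negbTE jJ) ?(negbTE jL) //.
by rewrite -!innE -!aut_mulE -!innM C.
Qed.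

Lemma conj_on_commute_disjoint i k (J L : {set 'I_N}) a b f g :
  k \notin J -> i \notin L -> (forall x, x \in J -> x \notin L) ->
  conj_on i J a f -> conj_on k L b g -> commute f g.
Proof.
move=> kJ iL JL fE gE; apply: vtx_aut_eq => j; rewrite !aut_mulE fE gE.
case: ifPn => jL; case: ifPn => jJ; rewrite ?fE ?gE ?autM ?autV ?autX ?fE ?gE
  ?(negbTE kJ) ?(negbTE iL) ?jJ ?jL ?(negbTE jJ) ?(negbTE jL) //.
by have := JL j jJ; rewrite jL.
Qed.

(** On [J], which contains [k] and [L], [f] is conjugation by [v i ^+ a], and [g] fixes [v i]. *)
Lemma conj_on_commute_nested i k (J L : {set 'I_N}) a b f g :
  k \in J -> i \notin L -> L \subset J ->
  conj_on i J a f -> conj_on k L b g -> commute f g.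
Proof.
move=> kJ iL /fintype.subsetP LJ fE gE.
apply: vtx_aut_eq => j; rewrite !aut_mulE fE gE.
case: ifPn => jL; case: ifPn => jJ; rewrite ?fE ?gE ?autM ?autV ?autX ?fE ?gE
  ?(negbTE iL) ?kJ ?jJ ?jL ?(negbTE jJ) ?(negbTE jL) //; last first.
  by rewrite (LJ _ jL) in jJ.
by rewrite -!(innE (v i ^+ a)) -autX -autV -!autM.
Qed.

(** * Graphs without a SIL *)

(** An edge can leave [J :&: L] only towards a common neighbour of [i] and [k]. So the component of
    [r] outside the common link stays in [J :&: L] and misses [i] and [k]. *)
Lemma SIL_of_star_closed i k (J L : {set 'I_N}) r : ~~ in_star i k ->
  star_closed i J -> star_closed k L -> k \notin J -> i \notin L ->
  r \in J -> r \in L -> contains_SIL e.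
Proof.
have step i' k' (J' L' : {set 'I_N}) x y : ~~ in_star i' k' ->
    star_closed i' J' -> star_closed k' L' -> k' \notin J' -> i' \notin L' ->
    x \in J' -> x \in L' -> ~~ e i' y -> e x y -> y \in J' :&: L'.
  move=> nik Jcl Lcl kJ iL xJ xL niy xy.
  have niy' : ~~ in_star i' y.
    rewrite negb_or niy andbT; apply: contraTneq xy => ->.
    have := star_closed_sub Jcl xJ; rewrite negb_or => /andP[_].
    by rewrite e_sym.
  have yJ : y \in J' by apply: contraR niy' => /(star_closed_adj Jcl xJ xy).
  rewrite finset.in_setI yJ; apply: contraR kJ => yL.
  have /orP[/eqP<- //|ky] := star_closed_adj Lcl xL xy yL.
  by apply: contraR nik; rewrite e_sym in ky; apply: (star_closed_adj Jcl yJ ky).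
move=> nik Jcl Lcl kJ iL rJ rL.
have [ri rk] := (star_closed_sub Jcl rJ, star_closed_sub Lcl rL).
have [|R RC [rR Rmin]] := @components_at _ e (~: (link e i :&: link e k)) r e_sym.
  by rewrite inE finset.in_setI !in_linkE // negb_and; move: ri; rewrite negb_or => /andP[_ ->].
have RJL : R \subset J :&: L.
  apply: Rmin; last by rewrite finset.in_setI rJ rL.
    apply/fintype.subsetP => x; rewrite finset.in_setI => /andP[xJ _].
    have := star_closed_sub Jcl xJ; rewrite negb_or => /andP[_ ix].
    by rewrite inE finset.in_setI !in_linkE // negb_and ix.
  move=> x y; rewrite finset.in_setI => /andP[xJ xL]; rewrite inE finset.in_setI !in_linkE //.
  rewrite negb_and => /orP[iy|ky] xy; first exact: (step i k J L x y).
  by rewrite finset.setIC; apply: (step k i L J x y) => //; rewrite in_star_sym.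
have iR : i \notin R.
  by apply: contra iL => /(fintype.subsetP RJL); rewrite finset.in_setI => /andP[].
have kR : k \notin R.
  by apply: contra kJ => /(fintype.subsetP RJL); rewrite finset.in_setI => /andP[].
have nik2 : ~~ gdist_le e i k 1 by rewrite gdist_le1.
have [lt_ik|lt_ki|ik] := ltngtP i k; last first.
- by rewrite (val_inj ik) in_star_refl in nik.
- exists k, i; split=> //; first by rewrite gdist_le1 -/(in_star k i) in_star_sym.
  by exists R; rewrite finset.setIC.
by exists i, k; split=> //; exists R.
Qed.

Definition avoids_min i (J : {set 'I_N}) : Prop :=
  forall j, min_outside_star e i j -> j \notin J.

Lemma min_outside_starP i j :
  reflect (~~ in_star i j /\ forall k, ~~ in_star i k -> (j <= k)%N)
          (min_outside_star e i j).
Proof.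
rewrite /min_outside_star in_starE; apply: (iffP andP) => -[ij jmin]; split=> //.
  by move=> k ik; have /forallP/(_ k) := jmin; rewrite in_starE ik.
by apply/forallP => k; rewrite in_starE; apply/implyP/jmin.
Qed.

Lemma min_outside_star_ex i k : ~~ in_star i k ->
  exists j, min_outside_star e i j.
Proof.
move=> ik; case: (@arg_minnP _ k (fun j => ~~ in_star i j) (@nat_of_ord N) ik) => j ij jmin.
by exists j; apply/min_outside_starP; split.
Qed.

Lemma avoids_minP i j (J : {set 'I_N}) :
  min_outside_star e i j -> j \notin J -> avoids_min i J.
Proof.
move=> /min_outside_starP[ij jmin] jJ k /min_outside_starP[ik kmin].
suff -> : k = j by [].
by apply/val_inj/eqP; rewrite eqn_leq kmin // jmin.
Qed.

(** * Commutation of the generators *)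

Section NoSIL.
Hypothesis noSIL : ~ contains_SIL e.

Lemma star_closed_disjoint i k J L : ~~ in_star i k ->
  star_closed i J -> star_closed k L -> k \notin J -> i \notin L ->
  forall x, x \in J -> x \notin L.
Proof.
move=> nik Jcl Lcl kJ iL x xJ; apply/negP => xL.
exact: noSIL (SIL_of_star_closed nik Jcl Lcl kJ iL xJ xL).
Qed.

Lemma star_closed_outside i k J x : ~~ in_star i k -> star_closed i J ->
  k \notin J -> x \in J -> ~~ in_star k x.
Proof.
move=> nik Jcl kJ xJ; apply/negP => /orP[/eqP xk|]; first by rewrite -xk xJ in kJ.
rewrite e_sym => xk; move/negP: nik; apply.
exact: star_closed_adj Jcl xJ xk kJ.
Qed.

Lemma in_star_compl i k J : ~~ in_star i k ->
  (k \in ~: star e i :\: J) = (k \notin J).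
Proof. by move=> nik; rewrite finset.in_setD in_starCE nik andbT. Qed.

Lemma star_closed_nested i k J L : ~~ in_star i k ->
  star_closed i J -> star_closed k L -> k \in J -> i \notin L -> L \subset J.
Proof.
move=> nik Jcl Lcl kJ iL; apply/fintype.subsetP => x xL; apply: contraLR xL => xJ.
have nki : ~~ in_star k i by rewrite in_star_sym.
apply/negP => xL; have nix := star_closed_outside nki Lcl iL xL.
suff : x \notin L by rewrite xL.
apply: (star_closed_disjoint nik (star_closed_compl Jcl) Lcl _ iL).
  by rewrite in_star_compl // kJ.
by rewrite in_star_compl.
Qed.

(** The complements of [J] and [L] outside the two stars miss [k] and [i], hence are disjoint. The
    vertex [a] is in the first, so outside the star of [k] and in [L]; minimality then bounds
    [b]. *)
Lemma min_outside_le i k J L a b : ~~ in_star i k ->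
  star_closed i J -> star_closed k L -> k \in J -> i \in L ->
  avoids_min i J -> min_outside_star e i a -> min_outside_star e k b ->
  (a \in L) && (b <= a)%N.
Proof.
move=> nik Jcl Lcl kJ iL iJ amin /min_outside_starP[_ bmin].
have [nia _] := min_outside_starP _ _ amin.
have nki : ~~ in_star k i by rewrite in_star_sym.
have Jcl' := star_closed_compl Jcl.
have kJ' : k \notin ~: star e i :\: J by rewrite in_star_compl // kJ.
have aJ' : a \in ~: star e i :\: J by rewrite in_star_compl // iJ.
have nka := star_closed_outside nik Jcl' kJ' aJ'.
rewrite bmin // andbT -[_ \in L]negbK -(in_star_compl _ nka).
apply: (star_closed_disjoint nik Jcl' (star_closed_compl Lcl) kJ' _ aJ').
by rewrite in_star_compl // iL.
Qed.

Lemma noSIL_commute i k J L a b f g :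
  star_closed i J -> star_closed k L -> avoids_min i J -> avoids_min k L ->
  conj_on i J a f -> conj_on k L b g -> commute f g.
Proof.
move=> Jcl Lcl iJ kL fE gE.
have [ik|nik] := boolP (in_star i k).
  exact: conj_on_commute_star ik Jcl Lcl fE gE.
have nki : ~~ in_star k i by rewrite in_star_sym.
have [iL|iL] := boolP (i \in L); have [kJ|kJ] := boolP (k \in J).
(* By symmetry the two minimal vertices coincide, and this vertex would lie in [L], which avoids
   it. *)
- have [ji jiP] := min_outside_star_ex nik.
  have [jk jkP] := min_outside_star_ex nki.
  have /andP[jiL le1] := min_outside_le nik Jcl Lcl kJ iL iJ jiP jkP.
  have /andP[_ le2] := min_outside_le nki Lcl Jcl iL kJ kL jkP jiP.
  have /val_inj jE : val jk = val ji by apply/eqP; rewrite eqn_leq le1.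
  by have := kL _ jkP; rewrite jE jiL.
- apply/commute_sym; apply: (conj_on_commute_nested iL kJ _ gE fE).
  exact: star_closed_nested nki Lcl Jcl iL kJ.
- exact: (conj_on_commute_nested kJ iL (star_closed_nested nik Jcl Lcl kJ iL) fE gE).
apply: (conj_on_commute_disjoint kJ iL _ fE gE).
exact: (star_closed_disjoint nik Jcl Lcl kJ iL).
Qed.

Lemma noSIL_Out0_abelian : abelian_set (@Out0 N e m).
Proof.
apply: abelian_subgroup_gen => f g [i [j [K [fP jmin jK]]]] [i' [j' [K' [gP jmin' jK']]]].
have [KC _] := fP; have [KC' _] := gP.
apply: noSIL_commute (partial_conj_on fP) (partial_conj_on gP).
- exact: component_star_closed.
- exact: component_star_closed.
- exact: avoids_minP jmin jK.
exact: avoids_minP jmin' jK'.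
Qed.

End NoSIL.

(** * Decomposition of conjugating automorphisms *)

Lemma conj_on_inn_compl i J a b f g : star_closed i J ->
  v i ^+ a * v i ^+ b = 1 ->
  conj_on i J a f -> conj_on i (~: star e i :\: J) b g -> f = inn (v i ^+ a) * g.
Proof.
move=> Jcl ab fE gE; apply: vtx_aut_eq => j; rewrite aut_mulE fE gE innE.
rewrite finset.in_setD in_starCE.
case: ifPn => jJ //=; case: ifPn => [_|].
  by rewrite !mulgA ab mul1g -mulgA -invgM ab invg1 mulg1.
rewrite negbK => /in_star_commute C; have /commute_sym -> := commuteX a C.
by rewrite mulgK.
Qed.

Section ConjugatingAutomorphisms.
Variable F : set (aut W).
Hypothesis F1 : F 1.
Hypothesis FM : forall i J a f p, star_closed i J -> avoids_min i J ->
  conj_on i J a f -> F p -> F (p * f).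

(** When [J] contains the minimal vertex, its complement conjugated the opposite way gives the same
    outer class. Normality moves the inner factors to the right. *)
Lemma mul_inn_conj_on p w i J a f : F p -> star_closed i J -> conj_on i J a f ->
  exists p' w', F p' /\ p * inn w * f = p' * inn w'.
Proof.
move=> Fp Jcl fE.
have [iJ|] := pselect (avoids_min i J).
  exists (p * f), (f^-1 w); split; first exact: FM fE Fp.
  by rewrite -mulgA inn_autC mulgA.
case/existsNP => j /not_implyP[jmin /negP]; rewrite negbK => jJ.
have Jcl' := star_closed_compl Jcl.
have [g gE] := conj_on_exists (a * (m i).-1) Jcl'.
have aV : v i ^+ a * v i ^+ (a * (m i).-1) = 1.
  by rewrite mulnC expgnA -vtxV expVgn mulgV.
rewrite (conj_on_inn_compl Jcl aV fE gE).
exists (p * g), (g^-1 (w * v i ^+ a)); split.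
  apply: FM gE Fp => //; apply: (avoids_minP jmin).
  by rewrite finset.in_setD jJ.
by rewrite -mulgA [inn w * _]mulgA -innM inn_autC mulgA.
Qed.

(* Laurence's peak reduction: as long as some wall separates [1] from another
   one, a partial conjugation brings the latter closer to [1]. *)
Lemma conj_aut_decomp (f : aut W) (g : 'I_N -> W) :
  (forall i, f (v i) = g i * v i * (g i)^-1) ->
  exists p w, F p /\ f = p * inn w.
Proof.
have [n] := ubnP (\sum_i len (g i))%N; elim: n f g => // n IH f g.
rewrite ltnS => le_n fE.
have sum_lt (g' : 'I_N -> W) i : (forall j, len (g' j) <= len (g j))%N ->
    (len (g' i) < len (g i))%N -> (\sum_j len (g' j) < n)%N.
  move=> gg' lt_i; apply: leq_trans le_n.
  rewrite (bigD1 i) //= [X in (_ < X)%N](bigD1 i) //= -addSn leq_add //.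
  exact: leq_sum.
(* A power of [v i] at the end of [g i] does not affect the conjugate and can be removed. *)
have [[i pi]|/forallNP g1] := pselect (exists i, proj i (g i)^-1 != 1).
  pose s := proj i (g i)^-1.
  have lt_i : (len (g i * s)%g < len (g i))%N.
    have [a aE] := projV_exists i (g i)^-1.
    by rewrite -lenV invgM -[X in (_ < X)%N]lenV len_projV.
  apply: (IH f (fun j => if j == i then g i * s else g j)) => [|j].
    apply: (sum_lt _ i) => [j|]; last by rewrite eqxx.
    by case: eqP => // ->; apply: ltnW.
  case: eqP => // ->; rewrite fE; have [a ->] : exists a, s = v i ^+ a.
    exact: proj_exists.
  by rewrite invgM -!mulgA; congr (_ * _); rewrite !mulgA -expgSr expgS mulgK.
have {}g1 i : proj i (g i)^-1 = 1 by apply/eqP/negPn/negP/g1.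
have [[i [k [nik pik]]]|/forallNP gg] := pselect (exists i k,
    ~~ in_star i k /\ proj i ((g i)^-1 * g k) != 1); last first.
  exists 1, 1; split=> //; rewrite inn1 mulg1; apply: conj_aut_rigid fE g1 _.
  move=> i j nij; apply/eqP/negPn/negP => pij; apply: (gg i).
  by exists j.
(* [c] names the sector of the wall of [i] that contains the wall of [k], and [J] gathers the
   vertices outside the star of [i] with walls in that sector. Adjacent vertices have meeting walls,
   so [J] is closed. *)
pose c := proj i ((g i)^-1 * g k).
pose J := [set j | ~~ in_star i j & proj i ((g i)^-1 * g j) == c].
have Jcl : star_closed i J.
  split; first by apply/fintype.subsetP => j; rewrite inE in_starCE => /andP[].
  move=> j l; rewrite inE in_starCE => /andP[nij /eqP pj] nil jl.
  rewrite inE nil -pj.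
  have [z [zj zl]] := commuting_walls_meet (conj_aut_adj fE jl).
  have <- := @proj_mul_par i j ((g i)^-1 * g j) _ (or_introl nij) zj.
  have <- := @proj_mul_par i l ((g i)^-1 * g l) _ (or_introl nil) zl.
  by rewrite -!mulgA !mulVKg eqxx.
have [a aE] := proj_exists i ((g i)^-1 * g k).
have [b bE] := projV_exists i ((g i)^-1 * g k).
have ba : v i ^+ (b + a) = 1 by rewrite expgnDr -aE -bE mulVg.
have [ha haE] := conj_on_exists a Jcl; have [hb hbE] := conj_on_exists b Jcl.
have hba : hb * ha = 1.
  apply: vtx_aut_eq => j; rewrite (conj_onM Jcl hbE haE) ba invg1 mul1g mulg1.
  by rewrite if_same.
(* Composing with [hb] folds the sector [c] onto that of 1, which shortens the conjugators indexed
   by [J], [g k] among them. *)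
pose g' j := if j \in J then g i * c^-1 * (g i)^-1 * g j else g j.
have lt_J j : j \in J -> (len (g' j) < len (g j))%N.
  move=> jJ; rewrite /g' jJ; move: jJ; rewrite inE => /andP[_ /eqP pj].
  by have := len_fold (g j) (g1 i); rewrite pj (negbTE pik) addn1.
have f'E j : (f * hb) (v j) = g' j * v j * (g' j)^-1.
  rewrite aut_mulE hbE /g'; case: ifP => _; last exact: fE.
  have fb : f (v i ^+ b) = g i * c^-1 * (g i)^-1.
    by rewrite autX fE -innE -autX innE -bE.
  by rewrite !autM autV fb fE !invgM !invgK !mulgA.
have [||p [w [Fp fhb]]] := IH (f * hb) g'; [|exact: f'E|].
  apply: (sum_lt _ k) => [j|]; last by apply: lt_J; rewrite inE nik eqxx.
  by have [/lt_J/ltnW //|nj] := boolP (j \in J); rewrite /g' (negbTE nj).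
have [p' [w' [Fp' E]]] := mul_inn_conj_on w Fp Jcl haE.
by exists p', w'; split=> //; rewrite -E -fhb -mulgA hba mulg1.
Qed.

End ConjugatingAutomorphisms.

(** * Finiteness of the outer automorphism group *)

Lemma finite_ball n : finite_set [set x : W | (len x <= n)%N]%classic.
Proof.
pose M := (\max_i m i).+1.
pose h (s : {bseq n of 'I_N * 'I_M}) := sylprod [seq (t.1, val t.2) | t <- s].
apply: (@sub_finite_set _ _ [set h s | s in setT]%classic); last first.
  exact/finite_image/finite_finset.
move=> x /= le_n; have [s ss ->] := len_sylprod x.
pose s' : seq ('I_N * 'I_M) := [seq (t.1, inord (t.2 %% m t.1)) | t <- s].
have s'n : (size s' <= n)%N by rewrite size_map ss.
exists (Bseq s'n) => //; rewrite /h /= -map_comp /sylprod big_map.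
apply: eq_bigr => -[i a] _ /=; rewrite inordK.
  by rewrite [in RHS](divn_eq a (m i)) expgnDr mulnC expgnA vtxX_order expg1n mul1g.
rewrite ltnS (leq_trans _ (leq_bigmax i)) // ltnW // ltn_mod.
exact: ltnW.
Qed.

Lemma noSIL_Out_finite : ~ contains_SIL e -> finite_set (@Out W).
Proof.
move=> noSIL.
pose P t f := [/\ star_closed t.1 t.2, avoids_min t.1 t.2 & conj_on t.1 t.2 1 f].
(* [chi] takes the default value 1 on pairs that are not admissible; the filter in [s] discards
   them. *)
have /choice[chi chiP] : forall t : 'I_N * {set 'I_N}, exists f,
    (exists f', P t f') -> P t f.
  move=> t; have [[f' Pf']|nf] := pselect (exists f', P t f'); last by exists 1.
  by exists f'.
pose s := [seq chi t | t <- enum {: 'I_N * {set 'I_N}} & `[< exists f', P t f' >]].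
have sP f : f \in s -> exists t, P t f.
  case/mapP => t; rewrite mem_filter => /andP[/asboolP Pt _] ->.
  by exists t; apply: chiP.
have [f /sP[t [tcl _ fE]]|f f' /sP[t [tcl ta fE]] /sP[t' [tcl' ta' fE']]|F [Ffin F1 FM]] :=
  @commuting_torsion_finite _ s.
- by exists (m t.1); [apply: ltnW|apply: conj_on_order fE].
- exact: (noSIL_commute noSIL tcl tcl' ta ta' fE fE').
have {}FM i J a f p : star_closed i J -> avoids_min i J ->
    conj_on i J a f -> F p -> F (p * f).
  move=> Jcl iJ fE Fp; have [h hE] := conj_on_exists 1 Jcl.
  have hs : h \in s.
    have ex : exists f', P (i, J) f' by exists h.
    apply/mapP; exists (i, J); first by rewrite mem_filter mem_enum andbT; apply/asboolP.
    by have [_ _ E] := chiP _ ex; apply: conj_on_uniq hE E.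
  have -> : f = h ^+ a.
    by apply: conj_on_uniq fE _; have := conj_onX a Jcl hE; rewrite mul1n.
  by elim: a {fE} => [|a IH]; rewrite ?mulg1 // expgSr mulgA; apply: FM.
(* Each [f (v i)] is torsion, so it has a conjugate in the ball of radius [N], listed by [B]. *)
have /finite_seqP[B BE] := finite_ball N.
have /choice[b bP] : forall fi : aut W * 'I_N,
    exists y, y \in B /\ exists g, fi.1 (v fi.2) = g * y * g^-1.
  case=> f i /=; have [|g gN] := @torsion_conj (f (v i)) (m i).-1.
    by rewrite prednK ?(ltnW (m_gt1 i)) // -autX vtxX_order aut1.
  exists (g * f (v i) * g^-1); split.
    by have : [set` B]%classic (g * f (v i) * g^-1) by rewrite -BE.
  by exists g^-1; rewrite invgK !mulgA mulVg mul1g mulgVK.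
(* Automorphisms with equal [tau] differ by one sending each [v i] to a conjugate of itself. Indices
   stay below [size B]; the successor only makes the type inhabited for [inord]. *)
pose tau (f : aut W) : {ffun 'I_N -> 'I_(size B).+1} :=
  [ffun i => inord (index (b (f, i)) B)].
have tauE f f' : tau f = tau f' -> forall i, b (f, i) = b (f', i).
  move=> ff' i; move/ffunP/(_ i)/(congr1 (@nat_of_ord _)): ff'; rewrite !ffunE.
  have bB h : b (h, i) \in B by have [] := bP (h, i).
  rewrite !inordK ?ltnS ?index_size // => /(congr1 (nth 1 B)).
  by rewrite !nth_index.
have /choice[r rP] : forall t, exists f, (exists f', tau f' = t) -> tau f = t.
  move=> t; have [[f' <-]|nf] := pselect (exists f', tau f' = t); last by exists 1.
  by exists f'.
pose coset (z : _ * aut W) := [set r z.1 * z.2 * h | h in @Inn W]%classic.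
pose D := ([set: {ffun 'I_N -> 'I_(size B).+1}] `*` F)%classic.
apply: (@sub_finite_set _ _ [set coset z | z in D]%classic); last first.
  exact/finite_image/finite_setX.
move=> _ [f _ <-]; pose f0 := r (tau f).
have f0E i : b (f0, i) = b (f, i) by apply: tauE; apply: rP; exists f.
have /choice[g gE] : forall i, exists g, (f0^-1 * f) (v i) = g * v i * g^-1.
  move=> i; have [_ [h0 h0E]] := bP (f0, i); have [_ [h hE]] := bP (f, i).
  rewrite /= f0E in h0E; rewrite /= in hE.
  exists (f0^-1 (h * h0^-1)); rewrite aut_mulE hE.
  have -> : h * b (f, i) * h^-1 = h * h0^-1 * f0 (v i) * (h * h0^-1)^-1.
    by rewrite h0E invgM invgK !mulgA !mulgVK.
  by rewrite autM (autV _ (h * _)) autM aut_VK.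
have [p [w [Fp fE]]] := conj_aut_decomp F1 FM gE.
exists (tau f, p); first by split.
have {}fE : f = f0 * p * inn w by rewrite -mulgA -fE mulVKg.
rewrite /coset /= -/f0; apply/seteqP; split=> _ [h /InnP[z ->] <-].
  exists (inn (w^-1 * z)); first by apply/InnP; exists (w^-1 * z).
  by rewrite fE -mulgA -innM mulVKg.
exists (inn (w * z)); first by apply/InnP; exists (w * z).
by rewrite fE innM mulgA.
Qed.

(** * Graphs with a SIL *)

Definition SIL_at i j (R : {set 'I_N}) : Prop :=
  [/\ ~~ in_star i j, R \in components e (~: star e i),
      R \in components e (~: star e j), i \notin R & j \notin R].

Lemma SIL_at_sym i j R : SIL_at i j R -> SIL_at j i R.
Proof. by case=> *; split=> //; rewrite in_star_sym. Qed.

(** Neither [i] nor [j] lies in the common link or in [R], so [R] contains no neighbour of them.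
    Hence [R] avoids both stars and remains a component when either is removed. *)
Lemma contains_SIL_at : contains_SIL e -> exists i j R, SIL_at i j R.
Proof.
case=> i [j [_ nij [R [RC iR jR]]]]; rewrite gdist_le1 in nij.
have nji : ~~ in_star j i by rewrite in_star_sym.
have [r rR [/fintype.subsetP RA [Rcl Rmin]]] := componentsP e_sym RC.
have comp k : (forall x, ~~ in_star k x -> x \in ~: (link e i :&: link e j)) ->
    (forall x, x \in link e i :&: link e j -> e k x) -> k \notin R ->
    k \in ~: (link e i :&: link e j) -> R \in components e (~: star e k).
  move=> starA linkE kR kA.
  have RS x : x \in R -> x \in ~: star e k.
    move=> xR; rewrite in_starCE; apply/negP => /orP[/eqP xk|kx].
      by rewrite -xk xR in kR.
    by rewrite e_sym in kx; rewrite (Rcl _ _ xR kA kx) in kR.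
  have [K KC [rK Kmin]] := components_at e_sym (RS _ rR).
  suff -> : R = K by [].
  have KR : K \subset R.
    apply: Kmin => //; first exact/fintype.subsetP.
    by move=> x y xR; rewrite in_starCE => /starA; apply: Rcl xR.
  apply/eqP; rewrite finset.eqEsubset KR andbT.
  have [_ _ [KS [Kcl _]]] := componentsP e_sym KC.
  apply: Rmin => //.
    by apply/fintype.subsetP => x /(fintype.subsetP KR)/RA.
  move=> x y xK yA xy; apply: (Kcl x y xK _ xy); apply: RS.
  exact: Rcl (fintype.subsetP KR _ xK) yA xy.
have inL k x : (x \in link e k) = e k x by apply: in_linkE.
exists i, j, R; split=> //.
  apply: comp => // [x|x|]; rewrite ?finset.in_setC ?finset.in_setI ?inL ?e_irr //.
    by rewrite negb_or negb_and => /andP[_ ->].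
  by case/andP.
apply: comp => // [x|x|]; rewrite ?finset.in_setC ?finset.in_setI ?inL ?e_irr ?andbF //.
  by rewrite negb_or negb_and => /andP[_ ->]; rewrite orbT.
by case/andP.
Qed.

Lemma proj_vtxV_neq1 i : proj i (v i)^-1 != 1.
Proof. by rewrite vtxV proj_vtxX eqxx -vtxV invg_eq1 vtx_neq1. Qed.

(** Iterated along a word with consecutive letters nonadjacent, this detects its first letter and so
    tells such words apart. *)
Lemma proj_cons i k x : ~~ in_star i k -> proj k x != 1 -> proj i (v i * x) != 1.
Proof.
move=> nik /proj_excl px; rewrite -[v i]expg1 proj_vtxXM px ?mulg1 ?vtx_neq1 //.
by rewrite in_star_sym.
Qed.

Lemma proj_consV i k x :
  ~~ in_star i k -> proj k x != 1 -> proj i ((v i)^-1 * x) != 1.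
Proof.
move=> nik /proj_excl px; rewrite vtxV proj_vtxXM px ?mulg1 -?vtxV ?invg_eq1 ?vtx_neq1 //.
by rewrite in_star_sym.
Qed.

(** Each of [i] and [j] conjugates [R] if its minimal vertex is outside [R], and otherwise a
    component containing the other of the two. The two composites send [v r] with [r] in [R], or
    [v i] when neither conjugates [R], to words with different first letters. *)
Lemma SIL_at_not_abelian i j R : SIL_at i j R -> ~ abelian_set (@Out0 N e m).
Proof.
have gen k l K : K \in components e (~: star e k) -> min_outside_star e k l ->
    l \notin K -> exists2 f, @Out0 N e m f & conj_on k K 1 f.
  move=> KC lmin lK; have [f fE] := conj_on_exists 1 (component_star_closed KC).
  exists f => //; apply: sub_gen_smallest; exists k, l, K; split=> //.
have conjE k K f x : conj_on k K 1 f -> f (v x) =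
    if x \in K then v k * v x * (v k)^-1 else v x.
  by move=> ->; rewrite expg1.
have other k l (J : {set 'I_N}) a : ~~ in_star k l -> star_closed k J ->
    a \in J -> l \notin J -> exists K : {set 'I_N},
    [/\ K \in components e (~: star e k), a \notin K, l \in K &
        forall x, x \in K -> x \notin J].
  move=> nkl Jcl aJ lJ; have lS : l \in ~: star e k by rewrite in_starCE.
  have [K KC [lK Kmin]] := components_at e_sym lS; exists K.
  have [CS Ccl] := star_closed_compl Jcl.
  have KJ x : x \in K -> x \notin J.
    have /Kmin/(_ Ccl) : ~: star e k :\: J \subset ~: star e k by [].
    rewrite finset.in_setD lJ lS => /(_ isT)/fintype.subsetP KC' /KC'.
    by rewrite finset.in_setD => /andP[].
  by split=> //; apply/negP => /KJ; rewrite aJ.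
have main : forall i j (R : {set 'I_N}) a b, SIL_at i j R ->
    min_outside_star e i a -> min_outside_star e j b -> b \notin R ->
    ~ abelian_set (@Out0 N e m).
  move=> {}i {}j {}R a b [nij Ri Rj iR jR] amin bmin bR ab.
  have nji : ~~ in_star j i by rewrite in_star_sym.
  have [r rR _] := componentsP e_sym Ri.
  have nir := star_closed_sub (component_star_closed Ri) rR.
  have njr := star_closed_sub (component_star_closed Rj) rR.
  have nri : ~~ in_star r i by rewrite in_star_sym.
  have nrj : ~~ in_star r j by rewrite in_star_sym.
  have [g gO gE] := gen _ _ _ Rj bmin bR.
  have [aR|aR] := boolP (a \in R); last first.
    have [f fO fE] := gen _ _ _ Ri amin aR.
    have := congr1 (fun h : aut W => h (v r)) (ab _ _ fO gO).
    rewrite !aut_mulE (conjE _ _ _ _ fE) (conjE _ _ _ _ gE) rR !autM !autV.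
    rewrite !(conjE _ _ _ _ fE) !(conjE _ _ _ _ gE) rR (negbTE iR) (negbTE jR).
    rewrite -!mulgA => E.
    have := proj_cons nji (proj_cons nir (proj_cons nri (proj_consV nij (proj_vtxV_neq1 j)))).
    rewrite E (proj_excl nij) ?eqxx //.
    exact: proj_cons nij (proj_cons njr (proj_cons nrj (proj_consV nji (proj_vtxV_neq1 i)))).
  have [K [KC aK jK KR]] := other _ _ _ _ nij (component_star_closed Ri) aR jR.
  have [f fO fE] := gen _ _ _ KC amin aK.
  have rK : r \notin K by apply/negP => /KR; rewrite rR.
  have iK := star_closed_notin (component_star_closed KC).
  have := congr1 (fun h : aut W => h (v r)) (ab _ _ fO gO).
  rewrite !aut_mulE (conjE _ _ _ _ fE) (conjE _ _ _ _ gE) rR (negbTE rK).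
  rewrite !autM !autV !(conjE _ _ _ _ fE) !(conjE _ _ _ _ gE) rR (negbTE rK) jK.
  rewrite !invgM !invgK -!mulgA => E.
  have := proj_cons nij (proj_cons nji (proj_consV nir (proj_cons nri
    (proj_cons nij (proj_consV nji (proj_vtxV_neq1 i)))))).
  rewrite E (proj_excl nji) ?eqxx //.
  exact: proj_cons njr (proj_cons nrj (proj_vtxV_neq1 j)).
move=> S; have [nij Ri Rj iR jR] := S.
have nji : ~~ in_star j i by rewrite in_star_sym.
have [a amin] := min_outside_star_ex nij; have [b bmin] := min_outside_star_ex nji.
have [bR|bR] := boolP (b \in R); last exact: main S amin bmin bR.
have [aR|aR] := boolP (a \in R); last exact: main (SIL_at_sym S) bmin amin aR.
have [K [KC aK jK _]] := other _ _ _ _ nij (component_star_closed Ri) aR jR.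
have [L [LC bL iL _]] := other _ _ _ _ nji (component_star_closed Rj) bR iR.
have iK := star_closed_notin (component_star_closed KC).
have jL := star_closed_notin (component_star_closed LC).
have [f fO fE] := gen _ _ _ KC amin aK; have [g gO gE] := gen _ _ _ LC bmin bL.
move=> ab; have := congr1 (fun h : aut W => h (v i)) (ab _ _ fO gO).
rewrite !aut_mulE (conjE _ _ _ _ fE) (negbTE iK) (conjE _ _ _ _ gE) iL.
rewrite !autM !autV !(conjE _ _ _ _ fE) jK (negbTE iK) !invgM !invgK -!mulgA mulKg => E.
have := proj_cons nij (proj_cons nji (proj_cons nij (proj_consV nji (proj_vtxV_neq1 i)))).
rewrite E (proj_excl nji) ?eqxx //.
exact: proj_cons nji (proj_cons nij (proj_vtxV_neq1 j)).
Qed.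

(** * Outer automorphisms of infinite order *)

Lemma SIL_at_not_inner i j R f g n : SIL_at i j R ->
  conj_on i R 1 f -> conj_on j R 1 g -> ~ Inn ((g * f) ^+ n.+1).
Proof.
move=> [nij Ri Rj iR jR] fE gE; set h := g * f; pose w := v i * v j.
have nji : ~~ in_star j i by rewrite in_star_sym.
have [r rR _] := componentsP e_sym Ri.
have nri := star_closed_sub (component_star_closed Ri) rR.
have nrj := star_closed_sub (component_star_closed Rj) rR.
rewrite in_star_sym in nri; rewrite in_star_sym in nrj.
have hfix k : k \notin R -> h (v k) = v k.
  by move=> kR; rewrite aut_mulE fE (negbTE kR) gE (negbTE kR).
have hXfix k l : k \notin R -> (h ^+ l) (v k) = v k.
  by move=> kR; elim: l => [//|l IH]; rewrite expgS aut_mulE IH hfix.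
have hr : h (v r) = w * v r * w^-1.
  rewrite aut_mulE fE rR !expg1 !autM autV !gE rR (negbTE iR) !expg1.
  by rewrite invgM !mulgA.
have hXr l : (h ^+ l) (v r) = w ^+ l * v r * w ^- l.
  elim: l => [|l IH]; first by rewrite invg1 mulg1 mul1g.
  rewrite expgS aut_mulE IH !autM autV autX hr.
  have -> : h w = w by rewrite /w autM !hfix.
  by rewrite expgSr [(w ^+ l * w)^-1]invgM !mulgA.
(* Such a [z] centralizes [v j], so [proj i z] is 1. But [z] is also [w ^+ n.+1] times an element of
   [par r], which makes it begin with [v i]. *)
case/InnP => z hz.
have zC k : k \notin R -> par k z.
  move=> kR; apply: centralizer_par; have := hXfix k n.+1 kR.
  by rewrite hz innE /commute => E; rewrite -[in RHS]E mulgVK.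
have zr : par r (w ^- n.+1 * z).
  apply: centralizer_par; have := hXr n.+1; rewrite hz innE => E.
  rewrite /commute -mulgA; have -> : z * v r = z * v r * z^-1 * z by rewrite mulgVK.
  by rewrite E !mulgA mulVg mul1g.
have zE : z = w ^+ n.+1 * (w ^- n.+1 * z) by rewrite mulVKg.
have p1 k : ~~ in_star r k -> proj k (w ^- n.+1 * z) = 1.
  by move=> nrk; apply: proj_par_out nrk.
have step x : proj j x = 1 -> proj i (w * x) = v i /\ proj j (w * x) = 1.
  move=> pj; have wj : proj j (v j * x) = v j.
    by have := proj_vtxXM j 1 x; rewrite pj mulg1 expg1.
  have wi : proj i (w * x) = v i.
    have := proj_vtxXM i 1 (v j * x); rewrite expg1 mulgA => ->.
    by rewrite (proj_excl nji) ?mulg1 // wj vtx_neq1.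
  by split=> //; apply: (proj_excl nij); rewrite wi vtx_neq1.
have : proj i (w ^+ n.+1 * (w ^- n.+1 * z)) = v i.
  have : forall x l, proj j x = 1 -> proj i (w ^+ l.+1 * x) = v i /\
      proj j (w ^+ l.+1 * x) = 1.
    move=> x l px; elim: l => [|l [_ IH]]; first by rewrite expg1; apply: step.
    by rewrite expgS -[w * _ * x]mulgA; apply: step.
  by case/(_ (w ^- n.+1 * z) n (p1 _ nrj)).
rewrite -zE (proj_par_out (zC _ jR)) // => /esym/eqP.
by rewrite (negbTE (vtx_neq1 i)).
Qed.

(** Two powers of [g * f] in one coset would make a positive power inner. *)
Lemma SIL_Out_infinite : contains_SIL e -> ~ finite_set (@Out W).
Proof.
case/contains_SIL_at => i [j [R S]]; have [_ Ri Rj _ _] := S.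
have [f fE] := conj_on_exists 1 (component_star_closed Ri).
have [g gE] := conj_on_exists 1 (component_star_closed Rj).
pose coset n := [set (g * f) ^+ n * h | h in @Inn W]%classic.
have cosetI a b : (a < b)%N -> coset a = coset b -> False.
  move=> ab; move/seteqP => [_ /(_ ((g * f) ^+ b))].
  case=> [|x xI E]; first by exists 1; rewrite ?mulg1 //; apply/InnP; exists 1; rewrite inn1.
  apply: (@SIL_at_not_inner _ _ _ _ _ (b - a).-1 S fE gE).
  rewrite prednK ?subn_gt0 //.
  suff -> : (g * f) ^+ (b - a) = x by [].
  by apply: (mulgI ((g * f) ^+ a)); rewrite E -expgnDr subnKC // ltnW.
have coset_inj : injective coset.
  by move=> a b; have [ab /(cosetI _ _ ab)|ba /esym/(cosetI _ _ ba)|//] := ltngtP a b.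
case/finite_seqP => s sE.
have : (size (map coset (iota 0 (size s).+1)) <= size s)%N.
  apply: uniq_leq_size; first by rewrite map_inj_uniq ?iota_uniq.
  move=> _ /mapP[n _ ->]; have : @Out W (coset n) by exists ((g * f) ^+ n).
  by rewrite sE.
by rewrite size_map size_iota ltnn.
Qed.

End GraphProductTheory.

(** * Prime power labels and the cycle of implications *)

Lemma prime_power_gt1 q : prime_power q -> 1 < q.
Proof.
case=> p [a [p_pr a_gt0 ->]].
by rewrite -(expn0 p) ltn_exp2l ?prime_gt1.
Qed.

Theorem corollary1p11 (N : nat) (N_gt0 : 0 < N) (e : rel 'I_N)
    (e_sym : symmetric e) (e_irr : irreflexive e)
    (m : 'I_N -> nat) (m_pp : forall i : 'I_N, prime_power (m i)) :
  [<-> abelian_set (@Out0 N e m);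
       ~ contains_SIL e;
       finite_set (@Out (graph_product e m))].
Proof.
have m_gt1 i : 1 < m i by apply: prime_power_gt1.
tfae.
- by move=> ab /(contains_SIL_at e_sym e_irr)[i [j [R S]]];
    apply: (SIL_at_not_abelian e_sym e_irr m_gt1 S ab).
- exact: noSIL_Out_finite.
move=> fin; apply: noSIL_Out0_abelian => // SIL.
exact: (SIL_Out_infinite e_sym e_irr m_gt1 SIL fin).
Qed.
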